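(* For all integers $c\ge 4$ and $d\ge c$, there exists a connected graph $G$ such that $g(G)=2$, $eg(G)=3$, $seg(G)=c$ and $meg(G)=d$.
   Context: All graphs are finite, simple, undirected and connected. Let $G$ be such a graph with vertex set $V(G)$ and edge set $E(G)$. - A geodetic set of $G$ is a set $S\subseteq V(G)$ such that every vertex of $G$ lies on some (at least one) shortest path between some pair of distinct vertices of $S$. The geodetic number $g(G)$ is the minimum cardinality of a geodetic set. - An edge-geodetic set of $G$ is a set $S\subseteq V(G)$ such that every edge of $G$ lies on some (at least one) shortest path between some pair of distinct vertices of $S$. The edge-geodetic number $eg(G)$ is the minimum cardinality of an edge-geodetic set. - A strong edge-geodetic set of $G$ is a set $S\subseteq V(G)$ for which one can choose, for each unordered pair of distinct vertices $u,v\in S$, one specific shortest $u$--$v$ path $P_{uv}$, such that every edge of $G$ lies on at least one of the chosen paths. The strong edge-geodetic number $seg(G)$ is the minimum cardinality of a strong edge-geodetic set. - A monitoring edge-geodetic set (MEG-set) of $G$ is a set $S\subseteq V(G)$ such that for every edge $e\in E(G)$ there is a pair of distinct vertices $u,v\in S$ such that $e$ lies on every shortest $u$--$v$ path in $G$. The monitoring edge-geodetic number $meg(G)$ is the minimum cardinality of an MEG-set. *)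

(* Defs.v *)
From mathcomp Require Import all_boot.
Set Implicit Arguments.
Unset Strict Implicit.
Unset Printing Implicit Defensive.

Record sgraph := SGraph {
  vertex :> finType;
  adj : rel vertex;
  adj_sym : symmetric adj;
  adj_irr : irreflexive adj
}.

Arguments adj {G} x y : rename.

Definition connected_graph (G : sgraph) : Prop :=
  forall x y : G, connect (@adj G) x y.

Section Geodetic.
Variable G : sgraph.
Implicit Types (u v x y : G) (s : seq G) (S : {set G}).

(* A path is represented by the sequence of all its vertices, both ends
   included, so its length is (size s).-1. *)
Definition is_path u v s : bool :=
  if s is x :: p then [&& x == u, path adj x p, last x p == v & uniq s]
  else false.

Definition shortest_path u v s : Prop :=
  is_path u v s /\ forall t, is_path u v t -> size s <= size t.

Definition edge_on x y s : bool :=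
  ((x, y) \in zip s (behead s)) || ((y, x) \in zip s (behead s)).

Definition geodetic_set S : Prop :=
  forall x, exists u v s,
    [/\ u \in S, v \in S, u != v, shortest_path u v s & x \in s].

Definition edge_geodetic_set S : Prop :=
  forall x y, adj x y -> exists u v s,
    [/\ u \in S, v \in S, u != v, shortest_path u v s & edge_on x y s].

(* One path is chosen per unordered pair: the paths P u v and P v u are the
   same path traversed in opposite directions. *)
Definition strong_edge_geodetic_set S : Prop :=
  exists P : G -> G -> seq G,
    (forall u v, u \in S -> v \in S -> u != v ->
       shortest_path u v (P u v) /\ P v u = rev (P u v)) /\
    (forall x y, adj x y -> exists u v,
       [/\ u \in S, v \in S, u != v & edge_on x y (P u v)]).

Definition meg_set S : Prop :=
  forall x y, adj x y -> exists u v,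
    [/\ u \in S, v \in S, u != v &
        forall s, shortest_path u v s -> edge_on x y s].

Definition min_card (Q : {set G} -> Prop) (k : nat) : Prop :=
  (exists S, Q S /\ #|S| = k) /\ (forall S, Q S -> k <= #|S|).

End Geodetic.

(* The four parameters are relations "the parameter of G equals k": the
   one-vertex graph has no geodetic set, so no value is forced on it. *)
Definition geodetic_number (G : sgraph) (k : nat) : Prop :=
  min_card (@geodetic_set G) k.

Definition edge_geodetic_number (G : sgraph) (k : nat) : Prop :=
  min_card (@edge_geodetic_set G) k.

Definition strong_edge_geodetic_number (G : sgraph) (k : nat) : Prop :=
  min_card (@strong_edge_geodetic_set G) k.

Definition meg_number (G : sgraph) (k : nat) : Prop :=
  min_card (@meg_set G) k.

(* Main.v *)
Require Import Defs.
From mathcomp Require Import all_boot zify.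

Set Implicit Arguments.
Unset Strict Implicit.
Unset Printing Implicit Defensive.

(** All the graphs are blow-ups of small pictures: every vertex has a kind, two
    different vertices have a distance which depends on their kinds only, and
    the sizes of the kinds are the parameters. Geodesics, and hence the four
    parameters of the theorem, are then read off from distances: an edge xy is
    on a geodesic from u to v when d(u,x) + 1 + d(y,v) = d(u,v).

    A triangle forces eg >= 3, because the distance to a given vertex does not
    change along all three of its edges, so that the geodesics of one pair never
    cover them all ([edge_geodetic_ge3]). A monitoring set is a strong
    edge-geodetic set ([meg_strong]), and a vertex that other vertices can
    replace on every way between one of its neighbours and the remaining ones
    belongs to every monitoring set ([meg_forced]); so enlarging a kind of twins
    adds to meg one for one. It need not add to seg: the chosen paths may pass
    through many twins which are not ends themselves. The number that can be
    absorbed in this way is bounded by counting pairs, since the path of a pair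
    has one vertex at each distance from its origin ([shortest_inj], used
    through [card_le_rel]).

    Three families cover all pairs (c, d) but one.

    For c >= 5 and d <= c + 2, a graph with eight kinds, two of them of sizes
    k = c - 4 and j = d - c + 1 ([oct_realizes]).

    All other graphs are necklaces: 2 L levels in cyclic order, consecutive
    levels completely joined, where level 0 is a pair of adjacent vertices and
    the other levels are independent sets. The ends on level 0 with the
    opposite vertex on level L show eg = 3, two opposite single vertices show
    g = 2, and seg >= 4 always ([neck_strong_ge4]).

    For c + 3 <= d <= 2 c - 4, a necklace with L = 4, a level of c vertices and
    another of d - c - 2 vertices ([bulge_realizes]). The large level counts in
    full for meg, while a set for seg can leave out one of its vertices for
    each pair of ends around it.

    For d >= 2 c - 3, and for c = 4 < d, a necklace with two adjacent levels of
    c - 3 vertices (at least 2 in the first one), followed by a chain of m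
    levels of two vertices ([comb_realizes]). If c >= 5, both large levels
    count in full for meg, but in seg they cost no more than one of them: most
    of the edges between them are covered by the paths between the ends inside
    one of the levels, whose number is quadratic as well. The chain adds 2 m to
    meg and nothing to seg, as the paths from level L to the two ends on level 0
    pass through all its vertices.

    The pair (4, 4) is a hexagon with one doubled vertex ([hex_realizes]). *)

(** * Distances and geodesics *)

(** These four properties determine the graph distance; they make it possible
    to work with a closed formula for it. *)
Record is_dist (G : sgraph) (d : G -> G -> nat) : Prop := IsDist {
  dist_eq0 : forall x y, (d x y == 0) = (x == y);
  distC : forall x y, d x y = d y x;
  dist_adj : forall x y z, adj y z -> d x z <= (d x y).+1;
  dist_step : forall x y, x != y -> exists2 z, adj z y & d x y = (d x z).+1
}.

Lemma min_card_le (G : sgraph) (Q : {set G} -> Prop) k :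
  (exists S, Q S /\ #|S| <= k) -> (forall S, Q S -> k <= #|S|) -> min_card Q k.
Proof.
move=> [S [QS Sk]] kQ; split=> //; exists S; split=> //.
by apply/eqP; rewrite eqn_leq Sk kQ.
Qed.

Lemma card_set_seq (T : finType) (s : seq T) : #|[set x in s]| <= size s.
Proof. by rewrite cardsE; apply: card_size. Qed.

(** An injection given by a relation: it serves to count vertices by the pairs
    whose paths pass through them, where a pair is only known to exist. *)
Lemma card_le_rel (X Y : finType) (A : {set X}) (B : {set Y}) (R : X -> Y -> Prop) :
  (forall x, x \in A -> exists2 y, y \in B & R x y) ->
  (forall x x' y, x \in A -> x' \in A -> R x y -> R x' y -> x = x') ->
  #|A| <= #|B|.
Proof.
move=> AB Rinj.
have ex (x : {x | x \in A}) : exists y, y \in B /\ R (val x) y.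
  by have [y] := AB _ (valP x); exists y.
have [f fP] := fin_all_exists ex.
have finj : injective f.
  move=> x x' E; apply: val_inj; have [_ fx] := fP x; have [_ fx'] := fP x'.
  by apply: (Rinj _ _ (f x) (valP x) (valP x') fx); rewrite E.
have -> : #|A| = #|{: {x | x \in A}}| by rewrite card_sig; apply: eq_card.
rewrite -(card_imset _ finj); apply: subset_leq_card.
by apply/subsetP => _ /imsetP[x _ ->]; have [] := fP x.
Qed.

Definition realizes c d := exists G : sgraph,
  connected_graph G /\ geodetic_number G 2 /\ edge_geodetic_number G 3 /\
  strong_edge_geodetic_number G c /\ meg_number G d.

Section Distance.
Variables (G : sgraph) (d : G -> G -> nat).
Hypothesis dP : is_dist d.
Implicit Types (u v x y z : G) (s p : seq G) (S M : {set G}).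

Lemma distxx x : d x x = 0.
Proof. by apply/eqP; rewrite (dist_eq0 dP). Qed.

Lemma adjE x y : adj x y = (d x y == 1).
Proof.
apply/idP/eqP => [xy|dxy].
  have := dist_adj dP x xy; rewrite distxx.
  have : d x y != 0.
    by rewrite (dist_eq0 dP); apply: contraTneq xy => ->; rewrite adj_irr.
  lia.
have /(dist_step dP)[z zy]: x != y by rewrite -(dist_eq0 dP) dxy.
by rewrite dxy => -[/esym/eqP]; rewrite (dist_eq0 dP) => /eqP->.
Qed.

Lemma dist_path x y p : path adj y p -> d x (last y p) <= d x y + size p.
Proof.
elim: p y => [|z p IH] y /=; first by rewrite addn0.
by move=> /andP[yz /IH]; have := dist_adj dP x yz; clear; lia.
Qed.

Lemma geodesic_ex x y :
  exists p, [/\ path adj x p, last x p = y & size p = d x y].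
Proof.
have [n] := ubnP (d x y); elim: n y => // n IH y.
have [->|xy] := eqVneq x y; first by exists [::]; rewrite /= distxx.
have [z zy dxy] := dist_step dP xy; rewrite dxy ltnS => /IH[p [xp lp sp]].
exists (rcons p y); rewrite rcons_path last_rcons size_rcons lp zy xp sp.
by split.
Qed.

Lemma dist_triangle x y z : d x z <= d x y + d y z.
Proof.
by have [p [yp <- <-]] := geodesic_ex y z; exact: dist_path.
Qed.

Lemma dist_connected : connected_graph G.
Proof.
move=> x y; have [p [xp lp _]] := geodesic_ex x y.
by apply/connectP; exists p.
Qed.

(** On a walk of minimal length the i-th vertex is at distance i from the
    origin; in particular no vertex is repeated. *)
Lemma tight_walk u p q :
  path adj u (p ++ q) -> size (p ++ q) = d u (last u (p ++ q)) ->
  d u (last u p) = size p /\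
  d (last u p) (last u (p ++ q)) = size q.
Proof.
rewrite cat_path size_cat last_cat => /andP[up uq] E.
have := dist_path u up; rewrite distxx.
have := dist_path (last u p) uq; rewrite distxx.
have := dist_triangle u (last u p) (last (last u p) q); lia.
Qed.

Lemma tight_uniq u p :
  path adj u p -> size p = d u (last u p) -> uniq (u :: p).
Proof.
elim/last_ind: p => // p y IH.
rewrite -cats1 => up E; have [Ep _] := tight_walk up E.
move: (up); rewrite cat_path => /andP[up' _].
have := IH up' (esym Ep); rewrite -cat_cons cat_uniq /= => ->.
rewrite orbF andbT; apply/negP => /= yp.
suff: d u y <= size p.
  by move: E; rewrite last_cat size_cat /=; lia.
case/splitPl: yp up' => p1 p2 <-; rewrite cat_path => /andP[up1 _].
by apply: leq_trans (dist_path u up1) _; rewrite distxx size_cat leq_addr.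
Qed.

Lemma shortestP u v s :
  shortest_path u v s <-> is_path u v s /\ size s = (d u v).+1.
Proof.
split=> [[sP smin]|[sP E]]; split=> //.
  have [p [up lp sp]] := geodesic_ex u v.
  have /smin : is_path u v (u :: p).
    by rewrite /is_path eqxx up lp eqxx tight_uniq // sp lp.
  case: s sP {smin} => // x s /= /and4P[/eqP-> us /eqP lv _].
  by have := dist_path u us; rewrite distxx lv; lia.
move=> [|x t] //= /and4P[/eqP-> us /eqP lv _].
by have := dist_path u us; rewrite distxx lv E; lia.
Qed.

Lemma shortestW u v s :
  shortest_path u v s -> is_path u v s /\ size s = (d u v).+1.
Proof. by case: (shortestP u v s) => + _; apply. Qed.

Lemma shortest_cons u v p : path adj u p -> last u p = v -> size p = d u v ->
  shortest_path u v (u :: p).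
Proof.
move=> up lp sp; apply/shortestP; split; last by rewrite /= sp.
by rewrite /is_path eqxx up lp eqxx tight_uniq // lp sp.
Qed.

Lemma shortest1 u v : adj u v -> shortest_path u v [:: u; v].
Proof.
move=> uv; apply: shortest_cons; rewrite //= ?uv //.
by apply/esym/eqP; rewrite -adjE.
Qed.

Lemma shortest2 u c v : adj u c -> adj c v -> d u v = 2 ->
  shortest_path u v [:: u; c; v].
Proof. by move=> uc cv uv; apply: shortest_cons; rewrite //= uc cv. Qed.

Lemma shortest3 u c c' v : adj u c -> adj c c' -> adj c' v -> d u v = 3 ->
  shortest_path u v [:: u; c; c'; v].
Proof. by move=> uc cc cv uv; apply: shortest_cons; rewrite //= uc cc cv. Qed.

Lemma geodesic_fun :
  exists geo : G -> G -> seq G, forall u v, shortest_path u v (geo u v).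
Proof.
have geo u v : exists s : seq G, is_path u v s && (size s == (d u v).+1).
  have [p [up lp sp]] := geodesic_ex u v; exists (u :: p).
  by have /shortestW[-> ->] := shortest_cons up lp sp; rewrite eqxx.
exists (fun u v => xchoose (geo u v)) => u v; apply/shortestP.
by have /andP[? /eqP] := xchooseP (geo u v).
Qed.

Lemma shortest_rev u v s : shortest_path u v s -> shortest_path v u (rev s).
Proof.
move=> /shortestW[sP E]; apply/shortestP; split; last by rewrite size_rev E (distC dP).
case: s E sP => // x s E /and4P[/eqP xu us /eqP lv un].
case/lastP: s E us lv un => [|s y] E us lv un.
  by rewrite /= in lv *; rewrite -lv xu eqxx.
rewrite last_rcons in lv; subst x y.
have Er : rev (u :: rcons s v) = v :: rcons (rev s) u by rewrite rev_cons rev_rcons.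
rewrite Er /is_path eqxx last_rcons eqxx -Er rev_uniq un !andbT.
have := rev_path (@adj G) u (rcons s v).
rewrite last_rcons belast_rcons rev_cons => ->.
by rewrite (@eq_path _ _ (@adj G)) // => a b; rewrite adj_sym.
Qed.

Lemma shortest_split u v s1 x s2 : shortest_path u v (s1 ++ x :: s2) ->
  d u x = size s1 /\ d x v = size s2.
Proof.
move=> /shortestW[]; case: s1 => [|w s1] /= /and4P[/eqP-> us /eqP lv _] E.
  by rewrite distxx; split; lia.
have [] := @tight_walk u (rcons s1 x) s2.
- by rewrite cat_rcons.
- by rewrite cat_rcons lv; lia.
by rewrite cat_rcons lv last_rcons size_rcons.
Qed.

Lemma shortest_mem u v s x : shortest_path u v s -> x \in s ->
  d u x + d x v = d u v.
Proof.
move=> sP xs; move: sP; case/splitPr: xs => s1 s2 sP.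
have [-> ->] := shortest_split sP.
by move/shortestW: sP => [_]; rewrite size_cat /=; lia.
Qed.

Lemma shortest_next u v s x : shortest_path u v s -> x \in s -> x != v ->
  exists z, [/\ z \in s, adj x z, d u z = (d u x).+1 & d x v = (d z v).+1].
Proof.
move=> sP xs; move: sP; case/splitPr: xs => s1 [|z s2] sP xv.
  have [_] := shortest_split sP.
  by move/eqP; rewrite (dist_eq0 dP) (negPf xv).
exists z; have [Ex Exv] := shortest_split sP.
have sP' : shortest_path u v (rcons s1 x ++ z :: s2) by rewrite cat_rcons.
have [Ez Ezv] := shortest_split sP'; rewrite size_rcons in Ez.
rewrite mem_cat !inE eqxx !orbT Ex Ez Exv Ezv /=; split=> //.
have [+ _] := shortestW sP; case: (s1) => [|y s3] /= /and4P[_ + _ _].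
  by case/andP.
by rewrite cat_path /= => /and3P[_ _ /andP[]].
Qed.

Lemma shortest_between u v s x y : shortest_path u v s ->
  x \in s -> y \in s -> d u x <= d u y -> d u x + d x y = d u y.
Proof.
move=> sP xs ys; move: sP; case/splitPr: xs ys => s1 s2 ys sP le.
have [Ex Exv] := shortest_split sP.
move: ys; rewrite mem_cat => /orP[ys1|].
  case/splitPr: ys1 sP Ex => s3 s4; rewrite -catA => /shortest_split[Ey _] Ex.
  by move: le; rewrite Ex Ey size_cat /=; lia.
rewrite inE => /orP[/eqP->|ys2]; first by rewrite distxx addn0.
have xs2 : path adj x s2.
  have [+ _] := shortestW sP; case: (s1) => [|w s3] /= /and4P[/eqP wu].
    by rewrite wu.
  by rewrite cat_path /= => /and3P[].
case/splitPr: ys2 xs2 sP {le Exv} => s3 s4 xs2.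
rewrite -cat_cons catA => /shortest_split[Ey _].
have xy : path adj x (rcons s3 y).
  by move: xs2; rewrite -cat_rcons cat_path => /andP[].
have := dist_path x xy; rewrite distxx last_rcons size_rcons.
have := dist_triangle u x y; rewrite Ex Ey size_cat /=; lia.
Qed.

(** The place of a vertex on a shortest path is its distance from the origin. *)
Lemma shortest_inj u v s x y : shortest_path u v s -> x \in s -> y \in s ->
  d u x = d u y -> x = y.
Proof.
move=> sP xs ys E; have sh : forall z, z \in s -> index z s = d u z.
  move=> z zs; have := cat_take_drop (index z s) s.
  rewrite (drop_nth u) ?index_mem // nth_index // => Es.
  have /shortest_split[-> _] : shortest_path u v
      (take (index z s) s ++ z :: drop (index z s).+1 s) by rewrite Es.
  by rewrite size_takel ?index_size.
by rewrite -(nth_index u xs) -(nth_index u ys) !sh // E.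
Qed.

Lemma geodesic_through u x y v : adj x y -> d u x + 1 + d y v = d u v ->
  exists2 s, shortest_path u v s & edge_on x y s.
Proof.
move=> xy E; have [p [up lp sp]] := geodesic_ex u x.
have [q [yq lq sq]] := geodesic_ex y v.
exists (u :: p ++ y :: q).
  apply: shortest_cons; rewrite ?size_cat ?last_cat ?cat_path /= ?lp ?up ?xy //=.
  lia.
apply/orP; left; case/lastP: p up lp sp => [_ /= -> _|p z _]; first by rewrite inE eqxx.
rewrite last_rcons => -> _; rewrite /= cat_rcons.
elim: p u {E} => [|w p IH] u /=; first by rewrite !inE eqxx orbT.
by rewrite inE IH orbT.
Qed.

Lemma zip_behead x y s : (x, y) \in zip s (behead s) ->
  exists s1 s2, s = s1 ++ x :: y :: s2.
Proof.
elim: s => [|a [|b s] IH] //=; rewrite inE => /orP[/eqP[-> ->]|/IH[s1 [s2 E]]].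
  by exists [::], s.
by exists (a :: s1), s2; rewrite E.
Qed.

Lemma edge_on_cat x y s1 s2 : edge_on x y (s1 ++ x :: y :: s2).
Proof.
rewrite /edge_on; apply/orP; left; elim: s1 => [|a [|b s1] IH] /=;
  by rewrite ?inE ?eqxx // ?IH orbT.
Qed.

Lemma edge_onC x y s : edge_on x y s = edge_on y x s.
Proof. by rewrite /edge_on orbC. Qed.

Lemma edge_onP x y s : edge_on x y s ->
  (exists s1 s2, s = s1 ++ x :: y :: s2) \/ (exists s1 s2, s = s1 ++ y :: x :: s2).
Proof. by case/orP => /zip_behead; [left|right]. Qed.

Lemma edge_on_rev x y s : edge_on x y s -> edge_on x y (rev s).
Proof.
case/edge_onP => [] [s1 [s2 ->]]; rewrite rev_cat !rev_cons -!cats1 -!catA /=.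
  by rewrite edge_onC edge_on_cat.
by rewrite edge_on_cat.
Qed.

Lemma shortest_edge u v x y s1 s2 : shortest_path u v (s1 ++ x :: y :: s2) ->
  d u x + 1 + d y v = d u v.
Proof.
move=> sP; have [-> _] := shortest_split sP.
have [|_ ->] := @shortest_split u v (rcons s1 x) y s2; first by rewrite cat_rcons.
by move/shortestW: sP => [_]; rewrite size_cat /=; lia.
Qed.

Lemma shortest_route (f : nat -> G) i0 n :
  (forall i, i0 <= i < i0 + n -> adj (f i) (f i.+1)) ->
  d (f i0) (f (i0 + n)) = n ->
  shortest_path (f i0) (f (i0 + n)) [seq f i | i <- iota i0 n.+1].
Proof.
move=> fadj E; rewrite /=; apply: shortest_cons; last by rewrite size_map size_iota.
  elim: n i0 fadj {E} => //= n IH i0 fadj; rewrite fadj ?leqnn /= ?IH //; last lia.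
  by move=> i ii; apply: fadj; lia.
by rewrite last_map; congr f; elim: n i0 {fadj E} => [|n IH] i0 /=; rewrite ?IH; lia.
Qed.

Lemma edge_on_route (f : nat -> G) i0 n i : i0 <= i < i0 + n ->
  edge_on (f i) (f i.+1) [seq f i | i <- iota i0 n.+1].
Proof.
move=> ii; have -> : n.+1 = (i - i0) + (2 + (i0 + n - i).-1) by lia.
rewrite iotaD map_cat; have -> : i0 + (i - i0) = i by lia.
exact: edge_on_cat.
Qed.

(** * The four parameters in terms of distances *)

Lemma geodetic_setP S : 
  (forall x, exists u v, [/\ u \in S, v \in S, u != v & d u x + d x v = d u v]) ->
  geodetic_set S.
Proof.
move=> H x; have [u [v [uS vS uv E]]] := H x; exists u, v.
have [p [up lp sp]] := geodesic_ex u x; have [q [xq lq sq]] := geodesic_ex x v.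
exists (u :: p ++ q); split=> //.
  by apply: shortest_cons; rewrite ?size_cat ?last_cat ?cat_path ?lp ?up //; lia.
by rewrite -cat_cons mem_cat -lp mem_last.
Qed.

Lemma edge_geodetic_setP S :
  (forall x y, adj x y ->
     exists u v, [/\ u \in S, v \in S & d u x + 1 + d y v = d u v]) ->
  edge_geodetic_set S.
Proof.
move=> H x y xy; have [u [v [uS vS E]]] := H x y xy.
have [s sP xys] := geodesic_through xy E; exists u, v, s; split=> //.
by apply/eqP => uv; move: E; rewrite uv distxx; lia.
Qed.

Lemma edge_geodetic_dist S x y : edge_geodetic_set S -> adj x y ->
  exists u v, [/\ u \in S, v \in S & d u x + 1 + d y v = d u v].
Proof.
move=> H /H[u [v [s [uS vS _ sP]]]] /edge_onP[] [s1 [s2 Es]].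
  by exists u, v; rewrite Es in sP; rewrite (shortest_edge sP).
exists v, u; rewrite Es in sP; split=> //.
by have := shortest_edge sP; rewrite (distC dP v x) (distC dP y u) (distC dP v u); lia.
Qed.

(** Going along a triangle changes the distance to a given vertex by one at
    most twice, so a single pair cannot cover the three edges. *)
Lemma edge_geodetic_ge3 S x y z : adj x y -> adj y z -> adj x z ->
  edge_geodetic_set S -> 3 <= #|S|.
Proof.
move=> xy yz xz HS; rewrite leqNgt; apply/negP => S2.
have [u [v uvP]] : exists u v, forall a b, adj a b ->
    d u a + 1 + d b v = d u v \/ d u b + 1 + d a v = d u v.
  have [u [v [uS vS E]]] := edge_geodetic_dist HS xy; exists u, v => a b ab.
  have uv : u != v by apply/eqP => uv; move: E; rewrite uv distxx; lia.
  have SE : forall w, w \in S -> w = u \/ w = v.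
    have sub : [set u; v] \subset S by apply/subsetP => w /set2P[]->.
    have /eqP <- : [set u; v] == S by rewrite eqEcard sub cards2 uv.
    by move=> w /set2P.
  have [u' [v' [/SE[]-> /SE[]-> E']]] := edge_geodetic_dist HS ab.
  - by move: E'; rewrite distxx; lia.
  - by left.
  - right; move: E'; rewrite (distC dP v a) (distC dP b u) (distC dP v u); lia.
  - by move: E'; rewrite distxx; lia.
have T a b : adj a b -> d u a = (d u b).+1 \/ d u b = (d u a).+1.
  move=> ab; have := dist_adj dP u ab; have := ab; rewrite adj_sym.
  move/(dist_adj dP u).
  have := dist_triangle u a v; have := dist_triangle u b v.
  by have [] := uvP a b ab; lia.
by have := T _ _ xy; have := T _ _ yz; have := T _ _ xz; lia.
Qed.

Lemma geodetic_ge2 S : (exists x : G, True) -> geodetic_set S -> 2 <= #|S|.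
Proof.
move=> [x _] /(_ x)[u [v [s [uS vS uv _ _]]]].
have sub : [set u; v] \subset S by apply/subsetP => w /set2P[]->.
by have := subset_leq_card sub; rewrite cards2 uv.
Qed.

(** Adjacent twins see every other vertex at the same distance, so the edge
    joining them is only on the path between themselves. *)
Lemma true_twin_in S x y : adj x y ->
  (forall z, z != x -> z != y -> d z x = d z y) ->
  edge_geodetic_set S -> x \in S.
Proof.
move=> xy tw HS; have [u [v [uS vS E]]] := edge_geodetic_dist HS xy.
have xy1 : d x y = 1 by apply/eqP; rewrite -adjE.
have [<-|ux] //:= eqVneq u x.
have := dist_triangle u y v; have [uy|uy] := eqVneq u y.
  by move: E; rewrite uy distxx (distC dP y x); lia.
by rewrite -(tw u) //; lia.
Qed.

Lemma strong_edge_geodetic S : strong_edge_geodetic_set S -> edge_geodetic_set S.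
Proof.
move=> [P [PS PE]] x y /PE[u [v [uS vS uv xyP]]]; exists u, v, (P u v).
by split=> //; have [] := PS u v uS vS uv.
Qed.

(** A partial choice of paths, at most one for each unordered pair, can be
    completed to a strong choice. *)
Lemma strong_setP S (Q : G -> G -> seq G) :
  (forall u v, u \in S -> v \in S -> u != v -> Q u v <> [::] ->
     shortest_path u v (Q u v) /\ Q v u = [::]) ->
  (forall x y, adj x y -> exists u v,
     [/\ u \in S, v \in S, u != v & edge_on x y (Q u v)]) ->
  strong_edge_geodetic_set S.
Proof.
move=> QS QE.
have [geo geoP] := geodesic_fun.
pose P u v := if Q u v != [::] then Q u v else if Q v u != [::] then rev (Q v u)
  else if enum_rank u < enum_rank v then geo u v else rev (geo v u).
exists P; split=> [u v uS vS uv|x y /QE[u [v [uS vS uv xyQ]]]]; last first.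
  exists u, v; split=> //; rewrite /P; case: eqP => //= E.
  by move: xyQ; rewrite E.
rewrite /P; case: (altP eqP) => /= [Euv|/eqP/(QS _ _ uS vS uv)[uvP ->]]; last by [].
have vu : v != u by rewrite eq_sym.
case: (altP eqP) => /= [Evu|/eqP/(QS _ _ vS uS vu)[vuP _]]; last first.
  by rewrite revK; split=> //; apply: shortest_rev.
have : enum_rank u != enum_rank v :> nat.
  by apply: contra uv => /eqP/val_inj/enum_rank_inj->.
case: (ltngtP (enum_rank u) (enum_rank v)) => // _ _.
by rewrite revK; split=> //; apply: shortest_rev.
Qed.

(** In a strong choice the path of a pair read in the two directions is the
    same, so the edge can be given the orientation that one likes. *)
Lemma strong_oriented S (P : G -> G -> seq G) x y :
  (forall u v, u \in S -> v \in S -> u != v ->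
     shortest_path u v (P u v) /\ P v u = rev (P u v)) ->
  (exists u v, [/\ u \in S, v \in S, u != v & edge_on x y (P u v)]) ->
  exists u v s1 s2, [/\ u \in S, v \in S, shortest_path u v (P u v),
    P u v = s1 ++ x :: y :: s2 & d u x + 1 + d y v = d u v].
Proof.
move=> PS [u [v [uS vS uv /edge_onP[] [s1 [s2 E]]]]].
  have [uvP _] := PS u v uS vS uv; exists u, v, s1, s2; split=> //.
  by rewrite E in uvP; apply: shortest_edge uvP.
have [uvP E'] := PS u v uS vS uv; have vu : v != u by rewrite eq_sym.
have [vuP _] := PS v u vS uS vu.
exists v, u, (rev s2), (rev s1); have E2 : P v u = rev s2 ++ x :: y :: rev s1.
  by rewrite E' E rev_cat !rev_cons -!cats1 -!catA.
by split=> //; rewrite E2 in vuP; apply: shortest_edge vuP.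
Qed.

(** If x and y are the only vertices at their places on the geodesics from u
    to v, the edge xy is on all of these. *)
Lemma monitorP u v x y : d u x + 1 + d y v = d u v -> adj x y ->
  (forall z, d u z = d u x -> d z v = (d y v).+1 -> z = x) ->
  (forall z, d u z = (d u x).+1 -> d z v = d y v -> z = y) ->
  forall s, shortest_path u v s -> edge_on x y s.
Proof.
move=> E xy Ux Uy s sP; have [_ sz] := shortestW sP.
have s1 : d u x < size s by rewrite sz; lia.
have s2 : (d u x).+1 < size s by rewrite sz; lia.
have Es := cat_take_drop (d u x) s.
rewrite (drop_nth u s1) (drop_nth u s2) in Es.
set a := nth u s _ in Es; set b := nth u s _ in Es.
rewrite -Es in sP sz *; have tk : size (take (d u x) s) = d u x by rewrite size_takel // ltnW.
have [Ea Ea'] := shortest_split sP.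
have [|Eb Eb'] := @shortest_split u v (rcons (take (d u x) s) a) b (drop (d u x).+2 s).
  by rewrite cat_rcons.
rewrite size_rcons tk in Eb; rewrite tk in Ea; rewrite size_cat tk /= in sz Ea'.
have -> : a = x by apply: Ux => //; lia.
have -> : b = y by apply: Uy => //; lia.
exact: edge_on_cat.
Qed.

Lemma monitor_adj u v : adj u v ->
  forall s, shortest_path u v s -> edge_on u v s.
Proof.
move=> uv; have uv1 : d u v = 1 by apply/eqP; rewrite -adjE.
apply: monitorP => // [|z|z _]; rewrite ?distxx ?uv1 // => /eqP.
  by rewrite (dist_eq0 dP) => /eqP.
by rewrite (dist_eq0 dP) => /eqP.
Qed.

Lemma monitor_mid u c v : adj u c -> adj c v -> d u v = 2 ->
  (forall z, adj u z -> adj z v -> z = c) ->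
  forall s, shortest_path u v s -> edge_on u c s /\ edge_on c v s.
Proof.
move=> uc cv uv2 cU.
have uc1 : d u c = 1 by apply/eqP; rewrite -adjE.
have cv1 : d c v = 1 by apply/eqP; rewrite -adjE.
have midU z : d u z = 1 -> d z v = 1 -> z = c.
  by move=> /eqP uz /eqP zv; apply: cU; rewrite adjE.
have uU z : d u z = 0 -> z = u by move/eqP; rewrite (dist_eq0 dP) => /eqP.
have vU z : d z v = 0 -> z = v by move/eqP; rewrite (dist_eq0 dP) => /eqP.
by move=> s sP; split; apply: (monitorP _ _ _ _ sP);
  rewrite ?distxx ?uc1 ?cv1 ?uv2 // => z H1 H2; auto.
Qed.

(** Choose any geodesic for each pair: a pair which monitors an edge covers it
    whatever the choice is. *)
Lemma meg_strong S : meg_set S -> strong_edge_geodetic_set S.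
Proof.
move=> MS; have [geo geoP] := geodesic_fun.
pose Q u v := if enum_rank u < enum_rank v then geo u v else [::].
have QP u v : enum_rank u < enum_rank v -> shortest_path u v (Q u v).
  by move=> uv; rewrite /Q uv.
apply: (@strong_setP S Q) => [u v uS vS uv|x y /MS[u [v [uS vS uv uvP]]]].
  rewrite {1}/Q; case: ifP => // lt _; split; first exact: QP.
  by rewrite /Q ltnNge ltnW.
have : enum_rank u != enum_rank v :> nat.
  by apply: contra uv => /eqP/val_inj/enum_rank_inj->.
case: (ltngtP (enum_rank u) (enum_rank v)) => // lt _.
  by exists u, v; split=> //; apply: uvP; apply: QP.
exists v, u; split=> //; rewrite 1?eq_sym //.
rewrite -[Q v u]revK; apply: edge_on_rev; apply: uvP.
by apply: shortest_rev; apply: QP.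
Qed.

(** If every way out of x through v can be rerouted around v, then v is in all
    monitoring sets: a path which enters v from x and leaves it again has a
    competitor that avoids v. *)
Lemma meg_forced S v x : adj x v ->
  (forall y, adj v y -> y != x -> ~~ adj x y ->
     exists2 v', v' != v & adj x v' && adj v' y) ->
  meg_set S -> v \in S.
Proof.
move=> xv detour MS; have [a [b [aS bS ab abP]]] := MS _ _ xv.
wlog E : a b aS bS ab abP / d a x + 1 + d v b = d a b.
  have [p [ap lp sp]] := geodesic_ex a b; have geo := shortest_cons ap lp sp.
  have [[s1 [s2 Es]]|[s1 [s2 Es]]] := edge_onP (abP _ geo); rewrite Es in geo => H.
    exact: (H a b) (shortest_edge geo).
  apply: (H b a); rewrite 1?eq_sym //.
    by move=> s /shortest_rev/abP/edge_on_rev; rewrite revK.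
  by rewrite (distC dP b) (distC dP v) (distC dP b) -(shortest_edge geo); lia.
have [->|vb] //:= eqVneq v b; exfalso.
have bv : b != v by rewrite eq_sym.
have [y yv vy] := dist_step dP bv.
have T1 := dist_triangle a y b; rewrite (distC dP y b) in T1; rewrite (distC dP v b) in E.
have vy' : adj v y by rewrite adj_sym.
have [||v' v'v /andP[xv' v'y]] := detour y vy'.
- by apply/eqP => yx; move: T1 vy E; rewrite yx; clear; lia.
- by apply/negP => xy; have := dist_adj dP a xy; move: T1 E vy; clear; lia.
have [p [ap lp sp]] := geodesic_ex a x; have [q [yq lq sq]] := geodesic_ex y b.
have geo : shortest_path a b (a :: p ++ v' :: y :: q).
  apply: shortest_cons; rewrite ?size_cat ?last_cat ?cat_path /= ?lp ?ap ?xv' ?v'y //=.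
  by rewrite sp sq (distC dP y b); move: E vy; clear; lia.
have vs : v \in a :: p ++ v' :: y :: q.
  by case: (edge_onP (abP _ geo)) => -[s1 [s2 ->]]; rewrite !(mem_cat, inE) eqxx !orbT.
have v's : v' \in a :: p ++ v' :: y :: q by rewrite !(mem_cat, inE) eqxx !orbT.
case/eqP: v'v; apply: shortest_inj geo v's vs _.
have := dist_triangle a v b; rewrite (distC dP v b).
have := dist_adj dP a xv; have := dist_adj dP a xv'; have := dist_adj dP a v'y.
by move: T1 E vy; clear; lia.
Qed.

End Distance.

(** * Blow-ups *)

(** A blow-up has sz i vertices of kind i for each i < m. The table gives the
    distance of two different vertices from their kinds, so its diagonal holds
    1 for a clique and 2 for a set of false twins. *)
Record kind_dist (m : nat) (dk : nat -> nat -> nat) : Prop := KindDist {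
  kdC : forall i j, dk i j = dk j i;
  kd_gt0 : forall i j, i < m -> j < m -> 0 < dk i j;
  kd_adj : forall i j k, i < m -> j < m -> k < m -> dk j k = 1 ->
    dk i k <= (dk i j).+1;
  kd_step : forall i j, i < m -> j < m -> dk i j != 1 ->
    exists k, [/\ k < m, k != i, k != j, dk k j = 1 & dk i j = (dk i k).+1]
}.

Section Blowup.
Variables (m : nat) (sz : nat -> nat) (dk : nat -> nat -> nat).

(** Pairs of a kind and an index below its size; indices are taken from an
    interval which is long enough for all the kinds. *)
Definition bvert :=
  {x : 'I_m * 'I_(\max_(i < m) sz i) | x.2 < sz x.1}.
Implicit Types (x y z : bvert) (S : {set bvert}).

Definition kind x : nat := (val x).1.
Definition idx x : nat := (val x).2.

Lemma kind_lt x : kind x < m. Proof. exact: ltn_ord. Qed.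
Lemma idx_lt x : idx x < sz (kind x). Proof. exact: valP x. Qed.

Lemma bvert_inj x y : kind x = kind y -> idx x = idx y -> x = y.
Proof.
by move=> kxy ixy; apply/val_inj/eqP; rewrite -pair_eqE; apply/andP; split; apply/eqP/val_inj.
Qed.

Lemma bvert_ex i j : i < m -> j < sz i -> exists x, kind x == i /\ idx x == j.
Proof.
move=> im ji; have jb : j < \max_(i < m) sz i.
  by apply: leq_trans ji _; apply: (leq_bigmax (Ordinal im)).
by exists (Sub (Ordinal im, Ordinal jb) ji); rewrite /kind /idx !SubK !eqxx.
Qed.

Lemma bvert_mk : 0 < m -> 0 < sz 0 -> exists mk : nat -> nat -> bvert,
  forall i j, i < m -> j < sz i -> kind (mk i j) = i /\ idx (mk i j) = j.
Proof.
move=> m0 s0; have [x0 _] := bvert_ex m0 s0.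
exists (fun i j => odflt x0 [pick x | (kind x == i) && (idx x == j)]) => i j im ji.
case: pickP => [x /andP[/eqP ? /eqP ?] //|none].
by have [x [xi xj]] := bvert_ex im ji; have := none x; rewrite xi xj.
Qed.

Definition bdist x y := if x == y then 0 else dk (kind x) (kind y).

Hypothesis dkP : kind_dist m dk.

Lemma bdistC x y : bdist x y = bdist y x.
Proof. by rewrite /bdist eq_sym; case: ifP => // _; apply: kdC dkP _ _. Qed.

Definition badj x y := bdist x y == 1.

Lemma badj_sym : symmetric badj.
Proof. by move=> x y; rewrite /badj bdistC. Qed.

Lemma badj_irr : irreflexive badj.
Proof. by move=> x; rewrite /badj /bdist eqxx. Qed.

Definition blowup := SGraph badj_sym badj_irr.

Hypothesis sz_gt0 : forall i, i < m -> 0 < sz i.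

Lemma bdist_is_dist : is_dist (G := blowup) bdist.
Proof.
split=> [x y|x y|x y z|x y xy] /=.
- rewrite /bdist; case: (eqVneq x y) => [//|_].
  apply/negbTE.
  by rewrite -lt0n (kd_gt0 dkP) ?kind_lt.
- exact: bdistC.
- rewrite /adj /= /badj /bdist; have [->|yz] // := eqVneq y z; move/eqP => yz1.
  have [->//|xz] := eqVneq x z; have [->|xy] := eqVneq x y; first by rewrite yz1.
  exact: kd_adj (kind_lt x) (kind_lt y) (kind_lt z) yz1.
- have [xy1|xy1] := eqVneq (dk (kind x) (kind y)) 1.
    by exists x; rewrite /adj /= /badj /bdist ?eqxx (negPf xy) xy1.
  have [k [km kx ky ky1 E]] := kd_step dkP (kind_lt x) (kind_lt y) xy1.
  have [z [/eqP zk _]] := bvert_ex km (sz_gt0 km); exists z.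
    rewrite /adj /= /badj /bdist zk ky1; case: (eqVneq z y) => // zy.
    by move: ky; rewrite -zk zy eqxx.
  rewrite /bdist (negPf xy) zk E; case: (eqVneq x z) => // xz.
  by move: kx; rewrite -zk xz eqxx.
Qed.

Lemma bdist_kind x y : kind x != kind y -> bdist x y = dk (kind x) (kind y).
Proof. by rewrite /bdist; case: (eqVneq x y) => // ->; rewrite eqxx. Qed.

Lemma bdist_neq x y : x != y -> bdist x y = dk (kind x) (kind y).
Proof. by rewrite /bdist => /negPf->. Qed.

Lemma bdistxx x : bdist x x = 0.
Proof. by rewrite /bdist eqxx. Qed.

Lemma card_tail i r : i < m ->
  #|[set x | (kind x == i) && (r <= idx x)]| = sz i - r.
Proof.
move=> im; have H (j : 'I_(sz i - r)) : exists x, (kind x == i) && (idx x == j + r).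
  have [|x [? ?]] := @bvert_ex i (j + r) im; first by have := ltn_ord j; lia.
  by exists x; apply/andP.
pose f j := xchoose (H j).
have fP j : kind (f j) = i /\ idx (f j) = j + r.
  by have /andP[/eqP ? /eqP ?] := xchooseP (H j).
have finj : injective f.
  move=> j j' E; apply: val_inj => /=; have [_] := fP j; have [_] := fP j'.
  by rewrite E; lia.
rewrite -[RHS]card_ord -(card_imset _ finj); apply: eq_card => x; rewrite inE.
apply/andP/imsetP => [[/eqP kx rx]|[j _ ->]]; last first.
  by have [-> ->] := fP j; rewrite eqxx leq_addl.
have jlt : idx x - r < sz i - r by have := idx_lt x; rewrite kx; lia.
exists (Ordinal jlt) => //; have [fk fi] := fP (Ordinal jlt).
by apply: bvert_inj; rewrite ?fk ?fi //= subnK.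
Qed.

Lemma card_kind i : i < m -> #|[set x | kind x == i]| = sz i.
Proof.
move=> im; rewrite -[RHS]subn0 -(card_tail 0 im).
by apply: eq_card => x; rewrite !inE andbT.
Qed.

Lemma card_kinds (s : seq nat) : uniq s -> (forall i, i \in s -> i < m) ->
  #|[set x | kind x \in s]| = \sum_(i <- s) sz i.
Proof.
elim: s => [|i s IH] /=; first by rewrite big_nil => _ _; apply: eq_card0 => x; rewrite inE.
move=> /andP[is_ us] sm; rewrite big_cons -IH // => [|j js]; last first.
  by apply: sm; rewrite inE js orbT.
rewrite -card_kind; last by apply: sm; rewrite inE eqxx.
have dis : [set x | kind x == i] :&: [set x | kind x \in s] = set0.
  by apply/setP => x; rewrite !inE; apply/negP => /andP[/eqP->]; apply/negP.
rewrite -cardsUI dis cards0 addn0.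
by apply: eq_card => x; rewrite !inE.
Qed.

Lemma card_by_kind S : #|S| = \sum_(i < m) #|[set x in S | kind x == i]|.
Proof.
rewrite -sum1_card (partition_big (fun x : bvert => (val x).1) xpredT) //=.
apply: eq_bigr => i _; rewrite -sum1_card; apply: eq_bigl => x.
by rewrite !inE.
Qed.

Lemma card_kind_split S i : i < m ->
  #|[set x in S | kind x == i]| + #|[set x | (kind x == i) && (x \notin S)]| = sz i.
Proof.
move=> im; rewrite -(card_kind im) -(cardsID S [set x | kind x == i]).
by congr (_ + _); apply: eq_card => x; rewrite !inE andbC.
Qed.

Lemma card_kinds_le S (s : seq nat) : uniq s -> (forall i, i \in s -> i < m) ->
  (forall x, kind x \in s -> x \in S) -> \sum_(i <- s) sz i <= #|S|.
Proof.
move=> us sm sS; rewrite -(card_kinds us sm); apply: subset_leq_card.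
by apply/subsetP => x; rewrite inE; apply: sS.
Qed.

End Blowup.

(** * Pairs with d at most c + 2: a graph with eight kinds *)

(** Quantification over a boolean that stops at the first failure, so that a
    check over many booleans can be computed. *)
Definition both (P : bool -> bool) := if P true then P false else false.

Lemma bothP P b : both P -> P b.
Proof. by rewrite /both; case: ifP => //; case: b. Qed.

(** What a strong edge-geodetic set S of the eight-kind graph has to provide.
    The vertices are t, w (k copies), p (j copies), q, b, a, e, o. Here B says
    that some copy of w is not in S, pi is the number of copies of p in S, and
    sx says that x is in S. The remaining variables tell which of the
    alternative geodesics are chosen: xy_z says that the path of x and y passes
    through z, and tbP, qeP, oeP say that the path between e and some copy of p
    passes through b, q and o. The five conditions list the ways to cover the
    edges tb, qe, eo and tp, and, if w is missing, the edges bw and tw. *)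
Definition oct_cover (B : bool) pi (st sq sb sa se so tbP qeP oeP te_b to_b to_q to_p aq_o aq_p ta_p : bool) :=
  let te := st && se in let to := st && so in let aq := sq && sa in let ta := st && sa in
  [&& sb || te && te_b || to && to_b || se && tbP,
  sq && [|| se, so | sb] || te && ~~ te_b || to && to_q || se && qeP || aq && aq_o,
  se && [|| so, sa | oeP] || so && (sq || sb) || aq && aq_o || to && (to_q || to_b),
  (0 < pi) || ta && ta_p || to && to_p || aq && aq_p &
  ~~ B || [&& sa, sb & ta && ~~ ta_p || to && ~~ [|| to_b, to_q | to_p] || aq && ~~ (aq_o || aq_p)]].

(** The conditions cannot hold when S has fewer than k + 4 vertices. A path
    takes one vertex at each distance from its origin: so the path of e and one
    copy of p passes through at most one of b, q and o, hence the bound by pi,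
    and some alternatives for the paths of t and o, and of q and a, exclude each
    other. *)
Lemma oct_cover_few :
  all (fun pi => both (fun B => both (fun st => both (fun sq => both (fun sb => both (fun sa => both (fun se => both (fun so =>
    if B + 4 <= pi + st + sq + sb + sa + se + so then true else
  both (fun tbP => both (fun qeP => both (fun oeP => if pi < tbP + qeP + oeP then true else
  both (fun te_b => 
  both (fun to_b => both (fun to_q => both (fun to_p => if 1 < to_b + to_q + to_p then true else
  both (fun aq_o => both (fun aq_p => if aq_o && aq_p then true else
  both (fun ta_p => 
  ~~ oct_cover B pi st sq sb sa se so tbP qeP oeP te_b to_b to_q to_p aq_o aq_p ta_p)))))))))))))))))) (iota 0 5).
Proof. by vm_compute. Qed.

Section Octet.

(** Kinds 0 to 7 are t, w, p, q, b, a, e, o. *)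
Definition oct_table : seq (seq nat) :=
  [:: [:: 2; 1; 1; 1; 1; 2; 2; 3];
      [:: 1; 2; 2; 2; 1; 1; 2; 2];
      [:: 1; 2; 2; 2; 2; 1; 3; 2];
      [:: 1; 2; 2; 2; 2; 3; 1; 2];
      [:: 1; 1; 2; 2; 2; 2; 1; 2];
      [:: 2; 1; 1; 3; 2; 2; 2; 1];
      [:: 2; 2; 3; 1; 1; 2; 2; 1];
      [:: 3; 2; 2; 2; 2; 1; 1; 2]].

Definition oct_kdist i j := nth 0 (nth [::] oct_table i) j.

Lemma lt8P (P : nat -> bool) : all P (iota 0 8) -> forall i, i < 8 -> P i.
Proof. by move=> /allP H i i8; apply: H; rewrite mem_iota. Qed.

Lemma oct_kdist_dist : kind_dist 8 oct_kdist.
Proof.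
split=> [i j|i j i8 j8|i j k i8 j8 k8|i j i8 j8].
- have out a b : (8 <= a) || (8 <= b) -> oct_kdist a b = 0.
    rewrite /oct_kdist; case: (leqP 8 a) => [a8 _|a8 /= b8].
      by rewrite [nth [::] _ _]nth_default // nth_nil.
    rewrite nth_default //.
    by have /eqP-> := @lt8P (fun a => size (nth [::] oct_table a) == 8) isT _ a8.
  case: (leqP 8 i) => i8; first by rewrite !out ?i8 ?orbT.
  case: (leqP 8 j) => j8; first by rewrite !out ?j8 ?orbT.
  have := @lt8P (fun i => all (fun j => oct_kdist i j == oct_kdist j i) (iota 0 8)) isT i i8.
  by move=> /lt8P/(_ j j8)/eqP.
- have := @lt8P (fun i => all (fun j => 0 < oct_kdist i j) (iota 0 8)) isT i i8.
  by move/lt8P; apply.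
- have := @lt8P (fun i => all (fun j => all (fun k => (oct_kdist j k == 1) ==>
    (oct_kdist i k <= (oct_kdist i j).+1)) (iota 0 8)) (iota 0 8)) isT i i8.
  by move=> /lt8P/(_ j j8)/lt8P/(_ k k8)/implyP H /eqP.
- have := @lt8P (fun i => all (fun j => (oct_kdist i j != 1) ==> has (fun k =>
    [&& k != i, k != j, oct_kdist k j == 1 & oct_kdist i j == (oct_kdist i k).+1]) (iota 0 8))
    (iota 0 8)) isT i i8.
  move=> /lt8P/(_ j j8)/implyP H /H/hasP[k].
  by rewrite mem_iota => k8 /and4P[? ? /eqP ? /eqP ?]; exists k.
Qed.

Variables k j : nat.
Hypotheses (k_gt0 : 0 < k) (j_gt0 : 0 < j).

Definition oct_size i := if i == 1 then k else if i == 2 then j else 1.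

Lemma oct_size_gt0 i : i < 8 -> 0 < oct_size i.
Proof. by rewrite /oct_size; case: ifP => // _; case: ifP. Qed.

Definition oct := blowup oct_size oct_kdist_dist.
Local Notation d := (@bdist 8 oct_size oct_kdist).
Implicit Types (x y z u v w : oct) (S : {set oct}).

Let dP : is_dist (G := oct) d := bdist_is_dist oct_kdist_dist oct_size_gt0.

Lemma oct_single x y : kind x = kind y -> kind x != 1 -> kind x != 2 -> x = y.
Proof.
move=> kxy k1 k2; apply: bvert_inj => //.
have := idx_lt x; have := idx_lt y; rewrite /oct_size -kxy (negPf k1) (negPf k2).
by case: (idx x) => //; case: (idx y).
Qed.

(** Distances of kinds, for pairs in which one kind has a single vertex. *)
Definition dd i i' := if i == i' then 0 else oct_kdist i i'.

Lemma oct_dd x y : (kind x \notin [:: 1; 2]) || (kind y \notin [:: 1; 2]) ->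
  d x y = dd (kind x) (kind y).
Proof.
rewrite /dd !inE !negb_or => H; case: (eqVneq (kind x) (kind y)) => [kxy|]; last exact: bdist_kind.
have -> : x = y; last by rewrite bdistxx.
by apply: oct_single => //; move: H; rewrite kxy orbb => /andP[].
Qed.

Lemma oct_adj x y : adj x y = (oct_kdist (kind x) (kind y) == 1).
Proof.
rewrite /adj /= /badj /bdist; case: (eqVneq x y) => // ->.
by have /negPf-> := @lt8P (fun i => oct_kdist i i != 1) isT _ (kind_lt y).
Qed.

Definition oct_edges : seq (nat * nat) :=
  [:: (5,1); (1,0); (5,2); (2,0); (0,3); (0,4); (4,1); (4,6); (6,3); (5,7); (7,6)].

Lemma oct_edge_ind (Q : oct -> oct -> Prop) :
  (forall x y, Q x y -> Q y x) ->
  (forall x y, adj x y -> (kind x, kind y) \in oct_edges -> Q x y) ->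
  forall x y, adj x y -> Q x y.
Proof.
move=> Qsym QE x y xy; have : ((kind x, kind y) \in oct_edges) || ((kind y, kind x) \in oct_edges).
  have := @lt8P (fun i => all (fun i' => (oct_kdist i i' == 1) ==>
    (((i, i') \in oct_edges) || ((i', i) \in oct_edges))) (iota 0 8)) isT _ (kind_lt x).
  by move=> /lt8P/(_ _ (kind_lt y))/implyP; apply; rewrite -oct_adj.
by case/orP => E; [apply: QE | apply: Qsym; apply: QE; rewrite // adj_sym].
Qed.

Lemma oct_vertex i r : i < 8 -> r < oct_size i -> exists x : oct, kind x = i /\ idx x = r.
Proof. by move=> i8 ri; have [x [/eqP ? /eqP ?]] := bvert_ex i8 ri; exists x. Qed.

Lemma oct_kind_ex i : i < 8 -> exists x : oct, kind x = i.
Proof. by move=> i8; have [x []] := oct_vertex i8 (oct_size_gt0 i8); exists x. Qed.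

Lemma oct_connected : connected_graph oct.
Proof. exact: dist_connected dP. Qed.

(** The vertices t and o are at distance 3, and every kind is between them. *)
Lemma oct_geodetic : geodetic_number oct 2.
Proof.
have [t kt] := @oct_kind_ex 0 isT; have [o ko] := @oct_kind_ex 7 isT.
split; last by move=> S; apply: geodetic_ge2; exists t.
have to : t != o by apply/eqP => E; move: kt; rewrite E ko.
exists [set t; o]; split; last by rewrite cards2 to.
apply: (geodetic_setP dP) => x; exists t, o; rewrite !inE !eqxx orbT to; split=> //.
have -> : d t o = 3 by rewrite oct_dd kt ko.
rewrite !oct_dd ?kt ?ko ?orbT //.
apply/eqP.
by have := @lt8P (fun i => dd 0 i + dd i 7 == 3) isT _ (kind_lt x).
Qed.

Lemma oct_edge_geodetic : edge_geodetic_number oct 3.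
Proof.
have [t kt] := @oct_kind_ex 0 isT; have [w kw] := @oct_kind_ex 1 isT.
have [q kq] := @oct_kind_ex 3 isT; have [b kb] := @oct_kind_ex 4 isT.
have [a ka] := @oct_kind_ex 5 isT.
apply: min_card_le; last first.
  by move=> S; apply: (@edge_geodetic_ge3 _ _ dP _ t w b);
    rewrite oct_adj ?kt ?kw ?kb.
exists [set x in [:: a; b; q]]; split; last exact: card_set_seq.
apply: (edge_geodetic_setP dP); apply: oct_edge_ind => [x y [u [v [uS vS E]]]|x y xy xyE].
  exists v, u; split=> //.
  by rewrite (distC dP v y) (distC dP x u) (distC dP v u) /=; lia.
have go u v : u \in [:: a; b; q] -> v \in [:: a; b; q] ->
    dd (kind u) (kind x) + 1 + dd (kind y) (kind v) = dd (kind u) (kind v) ->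
    exists u v, [/\ u \in [set x in [:: a; b; q]], v \in [set x in [:: a; b; q]]
      & d u x + 1 + d y v = d u v].
  have single z : z \in [:: a; b; q] -> kind z \notin [:: 1; 2].
    by rewrite !inE => /or3P[] /eqP->; rewrite ?ka ?kb ?kq.
  move=> uS vS E; exists u, v; rewrite !in_set uS vS; split=> //.
  by rewrite !oct_dd ?(single _ uS) ?(single _ vS) ?orbT.
have aS : a \in [:: a; b; q] by rewrite !inE eqxx.
have bS : b \in [:: a; b; q] by rewrite !inE eqxx orbT.
have qS : q \in [:: a; b; q] by rewrite !inE eqxx !orbT.
move: xyE; rewrite !inE; do ?[case/orP]; move=> /eqP[kx ky].
- by apply: (go a b) => //; rewrite ?kx ?ky ?ka ?kb ?kq.
- by apply: (go a q) => //; rewrite ?kx ?ky ?ka ?kb ?kq.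
- by apply: (go a q) => //; rewrite ?kx ?ky ?ka ?kb ?kq.
- by apply: (go a q) => //; rewrite ?kx ?ky ?ka ?kb ?kq.
- by apply: (go a q) => //; rewrite ?kx ?ky ?ka ?kb ?kq.
- by apply: (go q b) => //; rewrite ?kx ?ky ?ka ?kb ?kq.
- by apply: (go b a) => //; rewrite ?kx ?ky ?ka ?kb ?kq.
- by apply: (go b q) => //; rewrite ?kx ?ky ?ka ?kb ?kq.
- by apply: (go a q) => //; rewrite ?kx ?ky ?ka ?kb ?kq.
- by apply: (go a q) => //; rewrite ?kx ?ky ?ka ?kb ?kq.
- by apply: (go a q) => //; rewrite ?kx ?ky ?ka ?kb ?kq.
Qed.

Lemma kinds_neq x y : kind x != kind y -> x != y.
Proof. by apply: contraNneq => ->. Qed.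

(** All the copies of w and p together with q, b and o: each edge is on a
    geodesic of length at most 2, between two vertices of this set, which is the
    only one between them. *)
Lemma oct_meg_le : exists2 S : {set oct}, meg_set S & #|S| = k + j + 3.
Proof.
have [w0 kw0] := @oct_kind_ex 1 isT; have [p0 kp0] := @oct_kind_ex 2 isT.
have [q kq] := @oct_kind_ex 3 isT; have [b kb] := @oct_kind_ex 4 isT.
have [o ko] := @oct_kind_ex 7 isT.
pose M := [set x : oct | kind x \in [:: 1; 2; 3; 4; 7]].
exists M; last first.
  rewrite card_kinds //; first by rewrite !big_cons big_nil /oct_size /=; lia.
  by move=> i; rewrite !inE; do ?[case/orP]; move=> /eqP->.
apply: oct_edge_ind => [x y [u [v [uM vM uv H]]]|x y xy].
  by exists u, v; split=> // s /H; rewrite edge_onC.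
have mid (u c v : oct) : kind u \in [:: 1; 2; 3; 4; 7] -> kind v \in [:: 1; 2; 3; 4; 7] ->
    kind c \notin [:: 1; 2] -> [&& oct_kdist (kind u) (kind c) == 1,
    oct_kdist (kind c) (kind v) == 1, kind u != kind v, oct_kdist (kind u) (kind v) == 2 &
    all (fun i => (oct_kdist (kind u) i == 1) && (oct_kdist i (kind v) == 1) ==> (i == kind c))
      (iota 0 8)] ->
    [/\ u \in M, v \in M, u != v &
      forall s, shortest_path u v s -> edge_on u c s /\ edge_on c v s].
  move=> uM vM c1 /and5P[uc cv kuv uv2 cU]; rewrite !inE in uM vM *.
  rewrite uM vM kinds_neq //; split=> //; apply: (monitor_mid dP).
  - by rewrite oct_adj.
  - by rewrite oct_adj.
  - by rewrite bdist_kind //; apply/eqP.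
  move=> z; rewrite !oct_adj => uz zv; move: c1; rewrite !inE negb_or => /andP[c1 c2].
  have /implyP := lt8P cU (kind_lt z); rewrite uz zv => /(_ isT)/eqP kz.
  by apply: oct_single; rewrite // kz.
have goL (u : oct) : kind u \in [:: 1; 2; 3; 4; 7] -> kind y \in [:: 1; 2; 3; 4; 7] ->
    kind x \notin [:: 1; 2] -> [&& oct_kdist (kind u) (kind x) == 1,
    oct_kdist (kind x) (kind y) == 1, kind u != kind y, oct_kdist (kind u) (kind y) == 2 &
    all (fun i => (oct_kdist (kind u) i == 1) && (oct_kdist i (kind y) == 1) ==> (i == kind x))
      (iota 0 8)] -> exists u v, [/\ u \in M, v \in M, u != v &
        forall s, shortest_path u v s -> edge_on x y s].
  move=> uM yM x1 H; exists u, y; have [? ? ? E] := mid u x y uM yM x1 H.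
  by split=> // s /E[].
have goR (v : oct) : kind x \in [:: 1; 2; 3; 4; 7] -> kind v \in [:: 1; 2; 3; 4; 7] ->
    kind y \notin [:: 1; 2] -> [&& oct_kdist (kind x) (kind y) == 1,
    oct_kdist (kind y) (kind v) == 1, kind x != kind v, oct_kdist (kind x) (kind v) == 2 &
    all (fun i => (oct_kdist (kind x) i == 1) && (oct_kdist i (kind v) == 1) ==> (i == kind y))
      (iota 0 8)] -> exists u v, [/\ u \in M, v \in M, u != v &
        forall s, shortest_path u v s -> edge_on x y s].
  move=> xM vM y1 H; exists x, v; have [? ? ? E] := mid x y v xM vM y1 H.
  by split=> // s /E[].
rewrite !inE; do ?[case/orP]; move=> /eqP[kx ky].
- by apply: (goL o); rewrite ?kx ?ky ?ko.
- by apply: (goR q); rewrite ?kx ?ky ?kq.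
- by apply: (goL o); rewrite ?kx ?ky ?ko.
- by apply: (goR q); rewrite ?kx ?ky ?kq.
- by apply: (goL w0); rewrite ?kx ?ky ?kw0.
- by apply: (goL p0); rewrite ?kx ?ky ?kp0.
- exists x, y; rewrite !inE kx ky; split=> //; last exact: (monitor_adj dP).
  by rewrite kinds_neq // kx ky.
- by apply: (goR o); rewrite ?kx ?ky ?ko.
- by apply: (goL o); rewrite ?kx ?ky ?ko.
- by apply: (goL w0); rewrite ?kx ?ky ?kw0.
- by apply: (goR b); rewrite ?kx ?ky ?kb.
Qed.

(** On the way to t the copies of w and p can replace each other, and so can q
    and b; this forces k + j + 2 vertices. No two of these have a geodesic
    through the edge ao. *)
Lemma oct_meg_ge S : meg_set S -> k + j + 3 <= #|S|.
Proof.
move=> MS.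
have [t kt] := @oct_kind_ex 0 isT; have [w0 kw0] := @oct_kind_ex 1 isT.
have [p0 kp0] := @oct_kind_ex 2 isT; have [q kq] := @oct_kind_ex 3 isT.
have [b kb] := @oct_kind_ex 4 isT; have [a ka] := @oct_kind_ex 5 isT.
have [o ko] := @oct_kind_ex 7 isT.
have forced : forall x, kind x \in [:: 1; 2; 3; 4] -> x \in S.
  move=> x kx; apply: (@meg_forced _ _ dP S x t) MS; first rewrite oct_adj kt.
    by move: kx; rewrite !inE; do ?[case/orP]; move=> /eqP->.
  have [r kr H] : exists2 r : oct, kind r != kind x & all (fun i =>
      [&& oct_kdist (kind x) i == 1, i != 0 & oct_kdist 0 i != 1] ==>
      (oct_kdist 0 (kind r) == 1) && (oct_kdist (kind r) i == 1)) (iota 0 8).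
    move: kx; rewrite !inE; do ?[case/orP]; move=> /eqP->.
    - by exists p0; rewrite kp0.
    - by exists w0; rewrite kw0.
    - by exists b; rewrite kb.
    - by exists q; rewrite kq.
  move=> y; rewrite !oct_adj kt => xy yt ty; exists r; first exact: kinds_neq.
  rewrite !oct_adj kt; have /implyP := lt8P H (kind_lt y); apply.
  rewrite xy ty andbT; apply: contraNneq yt => ky; apply/eqP.
  by apply: oct_single; rewrite ky.
suff [s sS ks] : exists2 s, s \in S & kind s \notin [:: 1; 2; 3; 4].
  have : \sum_(i <- [:: 1; 2; 3; 4]) oct_size i <= #|S :\ s|.
    apply: card_kinds_le => // [i|x kx].
      by rewrite !inE; do ?[case/orP]; move=> /eqP->.
    by rewrite !inE forced // andbT; apply: contraNneq ks => <-.
  by rewrite (cardsD1 s S) sS !big_cons big_nil /oct_size /=; lia.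
have ao : @adj oct a o by rewrite oct_adj ka ko.
have [u [v [uS vS E]]] := edge_geodetic_dist dP
  (strong_edge_geodetic (meg_strong dP MS)) ao.
apply/exists_inP; apply: contraT; rewrite negb_exists_in => /forall_inP SM.
have {SM} SM s : s \in S -> kind s \in [:: 1; 2; 3; 4] by move/SM; rewrite negbK.
move: E; have [-> |uv] := eqVneq u v; first by rewrite bdistxx; lia.
rewrite (bdist_neq oct_kdist uv) !oct_dd ?ka ?ko ?orbT //.
by have := SM u uS; have := SM v vS; rewrite !inE; do ?[case/orP];
  move=> /eqP->; do ?[case/orP]; move=> /eqP->.
Qed.

(** All the copies of w and p with e, and also with a if there are only two
    copies of p. The paths from the copies of p to e have length 3, and each of
    them covers a different way through t or a. *)
Lemma oct_strong_le : j \in [:: 2; 3] ->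
  exists2 S : {set oct}, strong_edge_geodetic_set S & #|S| <= k + 4.
Proof.
move=> j23.
have [t kt] := @oct_kind_ex 0 isT; have [w0 kw0] := @oct_kind_ex 1 isT.
have [q kq] := @oct_kind_ex 3 isT; have [b kb] := @oct_kind_ex 4 isT.
have [a ka] := @oct_kind_ex 5 isT; have [e ke] := @oct_kind_ex 6 isT.
have [o ko] := @oct_kind_ex 7 isT.
have j2 : 1 < oct_size 2 by rewrite /oct_size /=; move: j23; rewrite !inE => /orP[] /eqP->.
have [p0 [kp0 ip0]] := @oct_vertex 2 0 isT (oct_size_gt0 (isT : 2 < 8)).
have [p1 [kp1 ip1]] := @oct_vertex 2 1 isT j2.
pose K := if j == 2 then [:: 1; 2; 6; 5] else [:: 1; 2; 6].
pose S := [set x : oct | kind x \in K].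
pose Q (u v : oct) : seq oct :=
  if (kind u == 6) && (kind v == 1) then [:: u; b; v]
  else if (kind u == 2) && (kind v == 6) then
    if idx u == 0 then [:: u; t; b; v]
    else if idx u == 1 then [:: u; t; q; v] else [:: u; a; o; v]
  else if (kind u == 2) && (kind v == 2) then
    if (idx u == 0) && (idx v == 1) then [:: u; a; v]
    else if (idx u == 0) && (idx v == 2) then [:: u; t; v] else [::]
  else if (kind u == 1) && (kind v == 2) then
    if idx v == 0 then [:: u; t; v] else if idx v == 2 then [:: u; a; v] else [::]
  else if (kind u == 5) && (kind v == 1) then [:: u; v]
  else if (kind u == 5) && (kind v == 6) then [:: u; o; v] else [::].
exists S; last first.
  rewrite card_kinds //; rewrite /K; first by move: j23; rewrite !inE => /orP[] /eqP jE;
    rewrite jE /= !big_cons big_nil /oct_size /= jE; lia.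
    by case: ifP.
  by move=> i; case: ifP => _; rewrite !inE; do ?[case/orP]; move=> /eqP->.
apply: (strong_setP dP (Q := Q)) => [u v uS vS uv|].
  have D2 i i' : oct_kdist i i' = 2 -> kind u = i -> kind v = i' -> d u v = 2.
    by move=> + ku kv; rewrite (bdist_neq oct_kdist uv) ku kv.
  have D3 i i' : oct_kdist i i' = 3 -> kind u = i -> kind v = i' -> d u v = 3.
    by move=> + ku kv; rewrite (bdist_neq oct_kdist uv) ku kv.
  rewrite {1 2}/Q; case: ifP => [/andP[/eqP ku /eqP kv] _|_].
    split; last by rewrite /Q ku kv.
    by apply: (shortest2 dP); rewrite ?oct_adj ?ku ?kv ?kb //; apply: D2 ku kv.
  case: ifP => [/andP[/eqP ku /eqP kv]|_].
    have Qvu : Q v u = [::] by rewrite /Q ku kv.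
    case: ifP => _; last case: ifP => _; split=> //; apply: (shortest3 dP);
      rewrite ?oct_adj ?ku ?kv ?kb ?kt ?kq ?ka ?ko //; apply: D3 ku kv => //.
  case: ifP => [/andP[/eqP ku /eqP kv]|_].
    case: ifP => [/andP[/eqP iu /eqP iv] _|_].
      split; last by rewrite /Q ku kv iu iv.
      by apply: (shortest2 dP); rewrite ?oct_adj ?ku ?kv ?ka //; apply: D2 ku kv.
    case: ifP => // /andP[/eqP iu /eqP iv] _.
    split; last by rewrite /Q ku kv iu iv.
    by apply: (shortest2 dP); rewrite ?oct_adj ?ku ?kv ?kt //; apply: D2 ku kv.
  case: ifP => [/andP[/eqP ku /eqP kv]|_].
    have Qvu : Q v u = [::] by rewrite /Q ku kv.
    case: ifP => _; last case: ifP => _ //; split=> //; apply: (shortest2 dP);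
      rewrite ?oct_adj ?ku ?kv ?kt ?ka //; apply: D2 ku kv => //.
  case: ifP => [/andP[/eqP ku /eqP kv] _|_].
    split; last by rewrite /Q ku kv.
    by apply: (shortest1 dP); rewrite oct_adj ku kv.
  case: ifP => // /andP[/eqP ku /eqP kv] _.
  split; last by rewrite /Q ku kv.
  by apply: (shortest2 dP); rewrite ?oct_adj ?ku ?kv ?ko //; apply: D2 ku kv.
have cov u v s x y : u \in S -> v \in S -> u != v -> Q u v = s ->
    edge_on x y s -> exists u v, [/\ u \in S, v \in S, u != v & edge_on x y (Q u v)].
  by move=> uS vS uv <- xys; exists u, v.
have KS x : kind x \in [:: 1; 2; 6] -> x \in S.
  by rewrite !inE /K; case: ifP => _; rewrite !inE; do ?[case/orP]; move=> ->; rewrite ?orbT.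
have eS : e \in S by apply: KS; rewrite ke.
have p0S : p0 \in S by apply: KS; rewrite kp0.
have p1S : p1 \in S by apply: KS; rewrite kp1.
have single x y : kind x = kind y -> kind y \notin [:: 1; 2] -> x = y.
  by rewrite !inE negb_or => E /andP[y1 y2]; apply: oct_single; rewrite // E.
have Qp0e : Q p0 e = [:: p0; t; b; e] by rewrite /Q kp0 ke ip0.
have Qp1e : Q p1 e = [:: p1; t; q; e] by rewrite /Q kp1 ke ip1.
have Qp01 : Q p0 p1 = [:: p0; a; p1] by rewrite /Q kp0 kp1 ip0 ip1.
apply: oct_edge_ind => [x y [u [v [? ? ? ?]]]|x y xy].
  by exists u, v; split=> //; rewrite edge_onC.
have p01 : p0 != p1 by apply/eqP => E; move: ip0; rewrite E ip1.
have p_idx (z : oct) : kind z = 2 -> [\/ z = p0, z = p1 | j = 3 /\ idx z = 2].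
  move=> kz; have := idx_lt z; rewrite kz /oct_size /=.
  case E: (idx z) => [|[|[|i]]] zj.
  - by constructor 1; apply: bvert_inj; rewrite ?kz ?E ?kp0 ?ip0.
  - by constructor 2; apply: bvert_inj; rewrite ?kz ?E ?kp1 ?ip1.
  - by constructor 3; move: j23 zj; rewrite !inE => /orP[] /eqP->.
  - by move: j23 zj; rewrite !inE => /orP[] /eqP->.
have p0e : p0 != e by rewrite kinds_neq ?kp0 ?ke.
have p1e : p1 != e by rewrite kinds_neq ?kp1 ?ke.
have WS z : kind z = 1 -> z \in S by move=> kz; rewrite KS ?kz.
have third : (j == 2) && (a \in S) \/ exists p2 : oct,
    [/\ kind p2 = 2, idx p2 = 2 & p2 \in S].
  have /orP[/eqP jE|/eqP jE] : (j == 2) || (j == 3) by move: j23; rewrite !inE.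
  left; have jE2 : j == 2 by apply/eqP.
    by rewrite jE2 inE /K jE2 ka.
  right.
  have [|p2 [kp2 ip2]] := @oct_vertex 2 2 isT; first by rewrite /oct_size /= jE.
  by exists p2; rewrite KS ?kp2.
rewrite !inE; do ?[case/orP]; move=> /eqP[kx ky].
- have [/andP[_ aS]|[p2 [kp2 ip2 p2S]]] := third.
    rewrite (single x a) ?ka //; apply: (cov a y [:: a; y]); rewrite ?(WS y) ?kinds_neq ?ka ?ky //.
      by rewrite /Q ka ky.
    by rewrite /edge_on /= !inE eqxx.
  apply: (cov y p2 [:: y; a; p2]); rewrite ?(WS y) ?kinds_neq ?ky ?kp2 //.
    by rewrite /Q ky kp2 ip2.
  by rewrite (single x a) ?ka // /edge_on /= !inE !xpair_eqE !eqxx ?orbT.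
- apply: (cov x p0 [:: x; t; p0]); rewrite ?(WS x) ?p0S ?kinds_neq ?kx ?kp0 //.
    by rewrite /Q kx kp0 ip0.
  by rewrite (single y t) ?kt // /edge_on /= !inE !xpair_eqE !eqxx ?orbT.
- have [->|->|[_ iy]] := p_idx y ky.
  + apply: (cov _ _ _ _ _ p0S p1S p01 Qp01).
    by rewrite (single x a) ?ka // /edge_on /= !inE !xpair_eqE !eqxx ?orbT.
  + apply: (cov _ _ _ _ _ p0S p1S p01 Qp01).
    by rewrite (single x a) ?ka // /edge_on /= !inE !xpair_eqE !eqxx ?orbT.
  apply: (cov y e [:: y; a; o; e]); rewrite ?(KS y) ?kinds_neq ?ky ?ke //.
    by rewrite /Q ky ke iy.
  by rewrite (single x a) ?ka // /edge_on /= !inE !xpair_eqE !eqxx ?orbT.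
- have [->|->|[_ ix]] := p_idx x kx.
  + apply: (cov _ _ _ _ _ p0S eS p0e Qp0e).
    by rewrite (single y t) ?kt // /edge_on /= !inE !xpair_eqE !eqxx ?orbT.
  + apply: (cov _ _ _ _ _ p1S eS p1e Qp1e).
    by rewrite (single y t) ?kt // /edge_on /= !inE !xpair_eqE !eqxx ?orbT.
  apply: (cov p0 x [:: p0; t; x]); rewrite ?(KS x) ?kx //.
  + by apply/eqP => E; move: ip0; rewrite E ix.
  + by rewrite /Q kx kp0 ip0 ix.
  by rewrite (single y t) ?kt // /edge_on /= !inE !xpair_eqE !eqxx ?orbT.
- apply: (cov _ _ _ _ _ p1S eS p1e Qp1e).
  by rewrite (single x t) ?kt // (single y q) ?kq // /edge_on /= !inE !xpair_eqE !eqxx ?orbT.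
- apply: (cov _ _ _ _ _ p0S eS p0e Qp0e).
  by rewrite (single x t) ?kt // (single y b) ?kb // /edge_on /= !inE !xpair_eqE !eqxx ?orbT.
- apply: (cov e y [:: e; b; y]); rewrite ?(WS y) ?kinds_neq ?ke ?ky //.
    by rewrite /Q ke ky.
  by rewrite (single x b) ?kb // /edge_on /= !inE !xpair_eqE !eqxx ?orbT.
- apply: (cov _ _ _ _ _ p0S eS p0e Qp0e).
  by rewrite (single x b) ?kb // (single y e) ?ke // /edge_on /= !inE !xpair_eqE !eqxx ?orbT.
- apply: (cov _ _ _ _ _ p1S eS p1e Qp1e).
  by rewrite (single x e) ?ke // (single y q) ?kq // /edge_on /= !inE !xpair_eqE !eqxx ?orbT.
- have [/andP[_ aS]|[p2 [kp2 ip2 p2S]]] := third.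
    apply: (cov a e [:: a; o; e]); rewrite ?kinds_neq ?ka ?ke //.
      by rewrite /Q ka ke.
    by rewrite (single x a) ?ka // (single y o) ?ko // /edge_on /= !inE !xpair_eqE !eqxx ?orbT.
  apply: (cov p2 e [:: p2; a; o; e]); rewrite ?kinds_neq ?kp2 ?ke //.
    by rewrite /Q kp2 ke ip2.
  by rewrite (single x a) ?ka // (single y o) ?ko // /edge_on /= !inE !xpair_eqE !eqxx ?orbT.
- have [/andP[_ aS]|[p2 [kp2 ip2 p2S]]] := third.
    apply: (cov a e [:: a; o; e]); rewrite ?kinds_neq ?ka ?ke //.
      by rewrite /Q ka ke.
    by rewrite (single x o) ?ko // (single y e) ?ke // /edge_on /= !inE !xpair_eqE !eqxx ?orbT.
  apply: (cov p2 e [:: p2; a; o; e]); rewrite ?kinds_neq ?kp2 ?ke //.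
    by rewrite /Q kp2 ke ip2.
  by rewrite (single x o) ?ko // (single y e) ?ke // /edge_on /= !inE !xpair_eqE !eqxx ?orbT.
Qed.

Lemma kinds8 (R : nat -> nat -> bool) (T : seq (nat * nat)) (x y : oct) :
  all (fun i => all (fun i' => (i != i') || (i \in [:: 1; 2]) ==> R i i' ==>
    ((i, i') \in T)) (iota 0 8)) (iota 0 8) ->
  x != y -> R (kind x) (kind y) -> (kind x, kind y) \in T.
Proof.
move=> /lt8P/(_ _ (kind_lt x))/lt8P/(_ _ (kind_lt y))/implyP H xy.
apply/implyP/H; apply: contraNT xy; rewrite !inE !negb_or negbK.
by move=> /andP[/eqP kxy /andP[x1 x2]]; apply/eqP/oct_single.
Qed.

(** The edge from b to a copy of w outside of S can only be covered by the path
    of b and a, which has room for one copy. So S misses at most one of them,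
    and it remains to see that covering the other edges takes four more
    vertices, or five; this is the finite check above. *)
Lemma oct_strong_ge S : strong_edge_geodetic_set S -> k + 4 <= #|S|.
Proof.
move=> [P [PS PE]].
have [t kt] := @oct_kind_ex 0 isT; have [w0 kw0] := @oct_kind_ex 1 isT.
have [p kp] := @oct_kind_ex 2 isT; have [q kq] := @oct_kind_ex 3 isT.
have [b kb] := @oct_kind_ex 4 isT; have [a ka] := @oct_kind_ex 5 isT.
have [e ke] := @oct_kind_ex 6 isT; have [o ko] := @oct_kind_ex 7 isT.
have single x y : kind x = kind y -> kind y \notin [:: 1; 2] -> x = y.
  by rewrite !inE negb_or => E /andP[y1 y2]; apply: oct_single; rewrite // E.
pose on u v z := [&& u \in S, v \in S & z \in P u v].
have onC u v z : u != v -> on u v z -> on v u z.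
  move=> uv /and3P[uS vS zP]; rewrite /on vS uS /=.
  by have [_ ->] := PS u v uS vS uv; rewrite mem_rev.
have on_inj u v z z' : u != v -> d u z = d u z' -> on u v z -> on u v z' -> z = z'.
  move=> uv E /and3P[uS vS zP] /and3P[_ _ zP'].
  by have [sP _] := PS u v uS vS uv; apply: (shortest_inj dP sP).
have route x y : adj x y -> exists u v, [/\ u != v, on u v x, on u v y
    & d u x + 1 + d y v = d u v].
  move=> xy; have [u [v [s1 [s2 [uS vS _ E Ed]]]]] := strong_oriented dP PS (PE x y xy).
  exists u, v; rewrite /on uS vS E !mem_cat !inE !eqxx !orbT; split=> //.
  by apply: contraPneq Ed => ->; rewrite bdistxx; lia.
pose pi := #|[set x in S | kind x == 2]|.
pose viaP z := (e \in S) && [exists x, [&& kind x == 2 & on x e z]].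
have pe x : kind x = 2 -> x != e by move=> kx; rewrite kinds_neq // kx ke.
have tb : (b \in S) || ((t \in S) && (e \in S)) && on t e b
    || ((t \in S) && (o \in S)) && on t o b || (e \in S) && viaP b.
  have [|u [v [uv _ yP E]]] := route t b; first by rewrite oct_adj kt kb.
  have /and3P[uS vS _] := yP.
  have : (kind u, kind v) \in [:: (0,4); (0,6); (0,7); (2,4); (2,6); (3,4)].
    apply: (@kinds8 (fun i i' => dd i 0 + 1 + dd 4 i' == oct_kdist i i')) => //.
    by move: E; rewrite (bdist_neq oct_kdist uv) !oct_dd ?kt ?kb ?orbT // => /eqP.
  rewrite !inE; do ?[case/orP]; move=> /eqP[ku kv].
  - by rewrite -(single v b) ?kb // vS.
  - by move: uS vS yP; rewrite (single u t) ?kt // (single v e) ?ke // => -> -> ->; rewrite ?orbT.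
  - by move: uS vS yP; rewrite (single u t) ?kt // (single v o) ?ko // => -> -> ->; rewrite ?orbT.
  - by rewrite -(single v b) ?kb // vS.
  - move: vS yP; rewrite (single v e) ?ke // /viaP => -> yP /=; apply/orP; right.
    by apply/existsP; exists u; rewrite ku yP.
  - by rewrite -(single v b) ?kb // vS.
have qe : (q \in S) && [|| e \in S, o \in S | b \in S]
    || ((t \in S) && (e \in S)) && on t e q || ((t \in S) && (o \in S)) && on t o q
    || (e \in S) && viaP q || ((q \in S) && (a \in S)) && on q a o.
  have [|u [v [uv xP yP E]]] := route q e; first by rewrite oct_adj kq ke.
  have /and3P[uS vS _] := yP.
  have : (kind u, kind v) \in [:: (3,6); (3,7); (3,4); (0,6); (0,7); (2,6); (3,5)].
    apply: (@kinds8 (fun i i' => dd i 3 + 1 + dd 6 i' == oct_kdist i i')) => //.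
    by move: E; rewrite (bdist_neq oct_kdist uv) !oct_dd ?kq ?ke ?orbT // => /eqP.
  rewrite !inE; do ?[case/orP]; move=> /eqP[ku kv].
  - by rewrite -(single u q) ?kq // -(single v e) ?ke // uS vS.
  - by rewrite -(single u q) ?kq // -(single v o) ?ko // uS vS !orbT.
  - by rewrite -(single u q) ?kq // -(single v b) ?kb // uS vS !orbT.
  - by move: uS vS xP; rewrite (single u t) ?kt // (single v e) ?ke // => -> -> ->; rewrite ?orbT.
  - by move: uS vS xP; rewrite (single u t) ?kt // (single v o) ?ko // => -> -> ->; rewrite ?orbT.
  - move: vS xP; rewrite (single v e) ?ke // /viaP => -> xP /=; apply/orP; left; apply/orP; right.
    by apply/existsP; exists u; rewrite ku xP.
  (* a geodesic from q to a which starts with e goes through o *)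
  - have Eu := single u q; have Ev := single v a; rewrite kq ka in Eu Ev.
    have [uE vE] : u = q /\ v = a by split; [apply: Eu | apply: Ev].
    move: uS vS yP uv; rewrite uE vE => qS aS /and3P[_ _ eP] uv.
    have [sP _] := PS q a qS aS uv.
    have [|z [zP ez _]] := shortest_next dP sP eP; first by rewrite kinds_neq ?ke ?ka.
    rewrite qS aS /on; have dea : d e a = 2 by rewrite oct_dd ke ka.
    rewrite dea => -[/esym/eqP]; rewrite -(adjE dP) => za.
    suff <- : z = o by rewrite qS aS zP !orbT.
    apply: single; rewrite ko //; apply/eqP; move: ez za; rewrite !oct_adj ke ka.
    move=> ez za; have := @lt8P (fun i => (oct_kdist 6 i == 1) && (oct_kdist i 5 == 1) ==> (i == 7))
      isT _ (kind_lt z).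
    by rewrite ez za.
have oe : (e \in S) && [|| o \in S, a \in S | viaP o]
    || (o \in S) && ((q \in S) || (b \in S)) || ((q \in S) && (a \in S)) && on q a o
    || ((t \in S) && (o \in S)) && (on t o q || on t o b).
  have [|u [v [uv xP yP E]]] := route e o; first by rewrite oct_adj ke ko.
  have /and3P[uS vS _] := yP.
  have : (kind u, kind v) \in [:: (6,7); (6,5); (6,2); (3,5); (3,7); (4,7); (0,7)].
    apply: (@kinds8 (fun i i' => dd i 6 + 1 + dd 7 i' == oct_kdist i i')) => //.
    by move: E; rewrite (bdist_neq oct_kdist uv) !oct_dd ?ke ?ko ?orbT // => /eqP.
  rewrite !inE; do ?[case/orP]; move=> /eqP[ku kv].
  - by rewrite -(single u e) ?ke // -(single v o) ?ko // uS vS.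
  - by rewrite -(single u e) ?ke // -(single v a) ?ka // uS vS !orbT.
  - move: uv uS yP; rewrite (single u e) ?ke // => uv eS yP.
    do 3 (apply/orP; left); rewrite /viaP eS /=; apply/or3P; constructor 3.
    by apply/existsP; exists v; rewrite kv /= onC.
  - by move: uS vS yP; rewrite (single u q) ?kq // (single v a) ?ka // => -> -> ->; rewrite ?orbT.
  - by rewrite -(single u q) ?kq // -(single v o) ?ko // uS vS !orbT.
  - by rewrite -(single u b) ?kb // -(single v o) ?ko // uS vS !orbT.
  (* the vertex between t and e is q or b *)
  have vu : v != u by rewrite eq_sym.
  have /and3P[_ _ eP] := onC _ _ _ uv xP; have [sP _] := PS v u vS uS vu.
  have [|z [zP ez _]] := shortest_next dP sP eP; first by rewrite kinds_neq ?ke ?ku.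
  have deu : d e u = 2 by rewrite oct_dd ke // ku.
  rewrite deu => -[/esym/eqP]; rewrite -(adjE dP) => zu.
  have onz : on u v z by apply: onC => //; rewrite /on uS vS.
  move: uS vS onz; rewrite (single u t) ?kt // (single v o) ?ko // => -> -> onz.
  rewrite [X in _ || X](_ : _ = true) ?orbT //=.
  have : kind z \in [:: 3; 4].
    have := @lt8P (fun i => (oct_kdist 6 i == 1) && (oct_kdist i 0 == 1) ==> (i \in [:: 3; 4]))
      isT _ (kind_lt z).
    by move: ez zu; rewrite !oct_adj ke ku => -> ->.
  rewrite !inE => /orP[] /eqP kz; first by rewrite -(single z q) ?kq // onz.
  by rewrite -(single z b) ?kb // onz orbT.
have pE : (0 < pi) || ((t \in S) && (a \in S)) && on t a p
    || ((t \in S) && (o \in S)) && on t o p || ((q \in S) && (a \in S)) && on q a p.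
  have [pS|pS] := boolP (p \in S).
    by rewrite card_gt0; apply/orP; left; apply/orP; left; apply/orP; left; apply/set0Pn; exists p; rewrite inE pS kp.
  have [|u [v [uv xP yP E]]] := route t p; first by rewrite oct_adj kt kp.
  have /and3P[uS vS _] := yP.
  have pv : p != v by apply: contraNneq pS => ->.
  have : (kind u, kind v) \in [:: (0,5); (0,7); (3,5)].
    apply: (@kinds8 (fun i i' => dd i 0 + 1 + oct_kdist 2 i' == oct_kdist i i')) => //.
    by move: E; rewrite (bdist_neq oct_kdist uv) (bdist_neq oct_kdist pv) oct_dd ?kt ?kp ?orbT // => /eqP.
  rewrite !inE; do ?[case/orP]; move=> /eqP[ku kv].
  - by move: uS vS yP; rewrite (single u t) ?kt // (single v a) ?ka // => -> -> ->; rewrite ?orbT.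
  - by move: uS vS yP; rewrite (single u t) ?kt // (single v o) ?ko // => -> -> ->; rewrite ?orbT.
  - by move: uS vS yP; rewrite (single u q) ?kq // (single v a) ?ka // => -> -> ->; rewrite ?orbT.
have wE w : kind w = 1 -> w \notin S -> on b a w /\
    ((t \in S) && (a \in S)) && on t a w
    || ((t \in S) && (o \in S)) && on t o w || ((q \in S) && (a \in S)) && on q a w.
  move=> kw wS; split.
    have [|u [v [uv xP yP E]]] := route b w; first by rewrite oct_adj kb kw.
    have /and3P[uS vS _] := yP.
    have wv : w != v by apply: contraNneq wS => ->.
    have : (kind u, kind v) \in [:: (4,5)].
      apply: (@kinds8 (fun i i' => dd i 4 + 1 + oct_kdist 1 i' == oct_kdist i i')) => //.
      by move: E; rewrite (bdist_neq oct_kdist uv) (bdist_neq oct_kdist wv) oct_dd ?kb ?kw ?orbT // => /eqP.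
    rewrite inE => /eqP[ku kv].
    by move: yP; rewrite (single u b) ?kb // (single v a) ?ka.
  have [|u [v [uv xP yP E]]] := route t w; first by rewrite oct_adj kt kw.
  have /and3P[uS vS _] := yP.
  have wv : w != v by apply: contraNneq wS => ->.
  have : (kind u, kind v) \in [:: (0,5); (0,7); (3,5)].
    apply: (@kinds8 (fun i i' => dd i 0 + 1 + oct_kdist 1 i' == oct_kdist i i')) => //.
    by move: E; rewrite (bdist_neq oct_kdist uv) (bdist_neq oct_kdist wv) oct_dd ?kt ?kw ?orbT // => /eqP.
  rewrite !inE; do ?[case/orP]; move=> /eqP[ku kv].
  - by move: uS vS yP; rewrite (single u t) ?kt // (single v a) ?ka // => -> -> ->; rewrite ?orbT.
  - by move: uS vS yP; rewrite (single u t) ?kt // (single v o) ?ko // => -> -> ->; rewrite ?orbT.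
  - by move: uS vS yP; rewrite (single u q) ?kq // (single v a) ?ka // => -> -> ->; rewrite ?orbT.
have te : t != e by rewrite kinds_neq ?kt ?ke.
have to : t != o by rewrite kinds_neq ?kt ?ko.
have qa : q != a by rewrite kinds_neq ?kq ?ka.
have ta : t != a by rewrite kinds_neq ?kt ?ka.
have ba : b != a by rewrite kinds_neq ?kb ?ka.
have neq x y : kind x != kind y -> x = y -> False by move=> /kinds_neq/eqP.
have excl u v z z' : u != v -> d u z = d u z' -> kind z != kind z' ->
    on u v z -> on u v z' -> False.
  by move=> uv E zz' zP /(on_inj _ _ _ _ uv E zP); apply: neq.
have pi_ge : viaP b + viaP q + viaP o <= pi.
  pose T z := [set x in S | (kind x == 2) && on x e z].
  have viaT z : viaP z <= #|T z|.
    rewrite /viaP; case: (e \in S) => //=; case: existsP => // -[x /andP[kx xz]].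
    rewrite card_gt0; apply/set0Pn; exists x; rewrite inE kx xz !andbT.
    by have /and3P[] := xz.
  have dis z z' : (forall x, kind x = 2 -> d x z = d x z') -> kind z != kind z' ->
      T z :&: T z' = set0.
    move=> E zz'; apply/setP => x; rewrite !inE; apply/negP.
    move=> /andP[/and3P[_ /eqP kx xz] /and3P[_ _ xz']].
    exact: (excl x e z z' (pe x kx) (E x kx) zz' xz xz').
  have E2 z : kind z \in [:: 3; 4; 7] -> forall x, kind x = 2 -> d x z = 2.
    move=> kz x kx; rewrite bdist_kind kx; move: kz; rewrite !inE;
    by do ?[case/orP]; move=> /eqP->.
  have : #|T b :|: T q :|: T o| <= pi.
    apply: subset_leq_card; apply/subsetP => x; rewrite !inE.
    by do ?[case/orP]; move=> /and3P[-> -> _].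
  have Db : T b :&: T q = set0.
    by apply: dis; rewrite ?kb ?kq // => x kx; rewrite !E2 ?kb ?kq.
  have Do : (T b :|: T q) :&: T o = set0.
    rewrite setIUl !dis ?setU0 ?kb ?kq ?ko // => x kx; by rewrite !E2 ?kb ?kq ?ko.
  have := cardsUI (T b :|: T q) (T o); rewrite Do cards0 addn0 => ->.
  have := cardsUI (T b) (T q); rewrite Db cards0 addn0 => ->.
  by apply: leq_trans; rewrite !leq_add ?viaT.
have W1 : #|[set x | kind x == 1] :\: S| <= 1.
  apply/card_le1_eqP => w w'; rewrite !inE => /andP[wS /eqP kw] /andP[wS' /eqP kw'].
  have [bw _] := wE w kw wS; have [bw' _] := wE w' kw' wS'.
  apply/esym/(on_inj b a w w' ba _ bw bw').
  by rewrite !bdist_kind ?kb ?kw ?kw'.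
pose B := #|[set x | kind x == 1] :\: S|.
have BE : B = (B != 0) by rewrite /B; move: W1; case: #|_| => [|[]].
have wP : ~~ (B != 0) || [&& a \in S, b \in S &
    ((t \in S) && (a \in S)) && ~~ on t a p
    || ((t \in S) && (o \in S)) && ~~ [|| on t o b, on t o q | on t o p]
    || ((q \in S) && (a \in S)) && ~~ (on q a o || on q a p)].
  have [//|] := eqVneq B 0; rewrite -lt0n card_gt0 => /set0Pn[w].
  rewrite !inE => /andP[wS /eqP kw]; have [/and3P[-> -> _] wr] := wE w kw wS.
  rewrite /=; move: wr; rewrite ?andbT; case/orP => [/orP[]|] /andP[-> wP] /=.
  - apply/orP; left; apply/orP; left; apply/negP => /(excl _ _ _ _ ta _ _ wP).
    by apply; rewrite ?bdist_kind ?kt ?kw ?kp.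
  - apply/orP; left; apply/orP; right; apply/negP.
    by case/or3P; apply: (excl _ _ _ _ to _ _ wP); rewrite ?bdist_kind ?kt ?kw ?kp ?kq ?kb.
  - apply/orP; right; apply/negP.
    by case/orP; apply: (excl _ _ _ _ qa _ _ wP); rewrite ?bdist_kind ?kq ?kw ?kp ?ko.
have count : (t \in S) + (k - (B != 0)) + pi + (q \in S) + (b \in S) + (a \in S)
    + (e \in S) + (o \in S) <= #|S|.
  have one x i : kind x = i -> (x \in S) <= #|[set x in S | kind x == i]|.
    move=> kx; case xS: (x \in S) => //.
    by rewrite card_gt0; apply/set0Pn; exists x; rewrite inE xS kx eqxx.
  have Wc : k - (B != 0) <= #|[set x in S | kind x == 1]|.
    have <- : #|[set x : oct | kind x == 1]| = k by rewrite card_kind.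
    rewrite -BE -(cardsID S) addnK; apply: subset_leq_card; apply/subsetP => x.
    by rewrite !inE andbC.
  rewrite (card_by_kind S) !big_ord_recr big_ord0 /= add0n.
  by rewrite !leq_add ?one ?kt ?kq ?kb ?ka ?ke ?ko.
have := oct_cover_few; move=> /allP H.
have [pi5|] := ltnP pi 5; last by move: count; clear; lia.
have /H{H} : pi \in iota 0 5 by rewrite mem_iota.
move=> /(bothP (B != 0))/(bothP (t \in S))/(bothP (q \in S))/(bothP (b \in S)).
move=> /(bothP (a \in S))/(bothP (e \in S))/(bothP (o \in S)).
case: ifP => [le _|_].
  move: count le; have := k_gt0; case: (B != 0); set n := #|S|; clear; lia.
move=> /(bothP (viaP b))/(bothP (viaP q))/(bothP (viaP o)).
rewrite ltnNge pi_ge /=; move=> /(bothP (on t e b))/(bothP (on t o b))/(bothP (on t o q)).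
move=> /(bothP (on t o p)); case: ifP => [two _|_].
  exfalso; move: two; have X := excl t o _ _ to.
  case tob: (on t o b); case toq: (on t o q); case top: (on t o p) => // _;
    by [apply: (X b q _ _ tob toq); rewrite ?bdist_kind ?kt ?kb ?kq
      | apply: (X b p _ _ tob top); rewrite ?bdist_kind ?kt ?kb ?kp
      | apply: (X q p _ _ toq top); rewrite ?bdist_kind ?kt ?kq ?kp].
move=> /(bothP (on q a o))/(bothP (on q a p)); case: ifP => [/andP[qo qp] _|_].
  by exfalso; apply: (excl _ _ _ _ qa _ _ qo qp); rewrite ?bdist_kind ?kq ?ko ?kp.
move=> /(bothP (on t a p)); rewrite /oct_cover tb oe pE wP andbT /=.
suff teq : on t e q -> ~~ on t e b.
  move/negP => necklace; case: necklace; move: qe; case E: (on t e q); first by rewrite (teq E) ?andbT.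
  by rewrite andbF orbF ?andbT => /orP[/orP[/orP[->|->]|->]|->]; rewrite ?orbT.
move=> xq; apply/negP => xb; apply: (excl _ _ _ _ te _ _ xb xq); rewrite ?bdist_kind ?kt ?kb ?kq //.
Qed.

(** With one copy of p the monitoring set has k + 4 vertices already. *)
Lemma oct_realizes : j <= 3 -> realizes (k + 4) (k + j + 3).
Proof.
move=> j3; exists oct; split; first exact: oct_connected.
split; first exact: oct_geodetic; split; first exact: oct_edge_geodetic.
have [M MM cM] := oct_meg_le; split; last first.
  apply: min_card_le; last exact: oct_meg_ge.
  by exists M; rewrite cM.
apply: min_card_le; last exact: oct_strong_ge.
have [j1|j1] := leqP j 1.
  by exists M; split; [exact: (meg_strong dP MM)|rewrite cM; lia].
have [|S SS cS] := oct_strong_le; last by exists S.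
by rewrite !inE; lia.
Qed.

End Octet.

(** * Necklaces *)

(** The diagonal makes level 0 a clique and the other levels independent. *)
Definition ndk L i j :=
  if i == j then (if i == 0 then 1 else 2)
  else minn ((i - j) + (j - i)) (2 * L - ((i - j) + (j - i))).

(** The distance of two different levels i and j is at most L, and it is the
    length of one of the two arcs between them. Without a minimum and truncated
    subtractions, this is linear arithmetic. *)
Definition arcdist L i j c :=
  i + c = j \/ j + c = i \/ i + 2 * L = j + c \/ j + 2 * L = i + c.

Lemma ndkE L i j : i < 2 * L -> j < 2 * L ->
  i = 0 /\ j = 0 /\ ndk L i j = 1 \/ 0 < i /\ i = j /\ ndk L i j = 2 \/
  i <> j /\ 0 < ndk L i j /\ ndk L i j <= L /\ arcdist L i j (ndk L i j).
Proof.
rewrite /ndk /arcdist; case: eqP => [->|] iL jL; last by right; right; lia.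
by case: (posnP j) => [->|j0]; [left|right; left].
Qed.

Lemma ndk_arc L i j c : i < 2 * L -> j < 2 * L -> 0 < c <= L -> i <> j ->
  arcdist L i j c -> ndk L i j = c.
Proof. by move=> iL jL c0 ij; have := ndkE iL jL; rewrite /arcdist; lia. Qed.

Lemma ndk_dist L : 2 < L -> kind_dist (2 * L) (ndk L).
Proof.
move=> L2; split=> [i j|i j iL jL|i j k iL jL kL jk|i j iL jL /eqP d1].
- by rewrite /ndk eq_sym addnC; case: eqP => // ->.
- by have := ndkE iL jL; rewrite /arcdist; lia.
- have jk' : j = k \/ arcdist L j k 1 by have := ndkE jL kL; rewrite jk /arcdist; lia.
  have := ndkE iL jL; have := ndkE iL kL; move: jk jk'; rewrite /arcdist.
  move: (ndk L i k) (ndk L i j) => a b; have := ndkE jL kL; rewrite /arcdist.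
  lia.
have [ij|/eqP ij] := eqVneq i j.
  have i0 : 0 < i /\ ndk L i i = 2 by have := ndkE iL iL; move: d1; rewrite -ij /arcdist; lia.
  pose k := if i.+1 == 2 * L then 0 else i.+1.
  have [kL ki ka] : [/\ k < 2 * L, k <> i & arcdist L k i 1].
    by rewrite /k /arcdist; case: eqP; split; lia.
  have ka' : arcdist L i k 1 by move: ka; rewrite /arcdist; lia.
  exists k; rewrite -ij (proj2 i0); split=> //; try exact/eqP.
    by apply: ndk_arc => //; lia.
  by rewrite (@ndk_arc L i k 1) //; lia.
set c := ndk L i j in d1 *.
have [c0 cL cP] : [/\ 1 < c, c <= L & arcdist L i j c] by have := ndkE iL jL; rewrite -/c /arcdist; split; lia.
have [k [kL kj kj1 ki]] : exists k, [/\ k < 2 * L, k <> j, arcdist L k j 1 & arcdist L i k c.-1].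
  rewrite /arcdist; case: cP => [E|[E|[E|E]]].
  - by exists j.-1; split; lia.
  - by exists j.+1; split; lia.
  - by exists (if j.+1 == 2 * L then 0 else j.+1); case: eqP; split; lia.
  - by exists (if j == 0 then (2 * L).-1 else j.-1); case: eqP; split; lia.
have ki' : k <> i by move: ki cP kj1; rewrite /arcdist; lia.
exists k; split=> //; [exact/eqP|exact/eqP|by apply: ndk_arc => //; lia|].
by rewrite (@ndk_arc L i k c.-1) //; lia.
Qed.

Section Necklace.
Variables (L : nat) (sz : nat -> nat).
Hypotheses (L2 : 2 < L) (sz0 : sz 0 = 2) (sz_gt0 : forall i, i < 2 * L -> 0 < sz i).

Definition necklace := blowup sz (ndk_dist L2).
Local Notation d := (@bdist (2 * L) sz (ndk L)).
Implicit Types (x y z u v w : necklace) (S : {set necklace}).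

Let dP : is_dist (G := necklace) d := bdist_is_dist (ndk_dist L2) sz_gt0.

(** Going around: level 2 L is level 0. *)
Definition nlev i := if i == 2 * L then 0 else i.

Lemma nlevE i : i = 2 * L /\ nlev i = 0 \/ i <> 2 * L /\ nlev i = i.
Proof. by rewrite /nlev; case: eqP; [left|right]. Qed.

Lemma level_lt x : kind x < 2 * L. Proof. exact: kind_lt. Qed.

Lemma neck_dist x y :
  kind x = kind y /\ idx x = idx y /\ d x y = 0 \/
  kind x = kind y /\ idx x <> idx y /\
    (kind x = 0 /\ d x y = 1 \/ 0 < kind x /\ d x y = 2) \/
  kind x <> kind y /\ 0 < d x y /\ d x y <= L /\ arcdist L (kind x) (kind y) (d x y).
Proof.
have [->|/eqP xy] := eqVneq x y; first by left; rewrite bdistxx.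
rewrite bdist_neq; last exact/eqP.
have := ndkE (level_lt x) (level_lt y); case=> [[x0 [y0 ->]]|[[x0 [xyk ->]]|[? ?]]].
- right; left; split; first by rewrite x0.
  by split; [move=> ixy; apply: xy; apply: bvert_inj; rewrite ?x0 ?y0|left].
- by right; left; split=> //; split; [move=> ixy; apply: xy; apply: bvert_inj|right].
- by right; right.
Qed.

Lemma neck_arc x y c : kind x <> kind y -> 0 < c <= L ->
  arcdist L (kind x) (kind y) c -> d x y = c.
Proof.
move=> xy c0 xyc; rewrite bdist_kind; last exact/eqP.
by apply: ndk_arc => //; apply: level_lt.
Qed.

Lemma neck_same x y : kind x = kind y -> sz (kind x) = 1 -> idx x = idx y.
Proof. by move=> kxy s1; have := idx_lt x; have := idx_lt y; rewrite -kxy s1; lia. Qed.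

Lemma neck_single x y : kind x = kind y -> sz (kind x) = 1 -> x = y.
Proof. by move=> kxy s1; apply: bvert_inj => //; apply: neck_same. Qed.

Lemma neck_vertex i r : i < 2 * L -> r < sz i -> exists x : necklace, kind x = i /\ idx x = r.
Proof. by move=> iL ri; have [x [/eqP ? /eqP ?]] := bvert_ex iL ri; exists x. Qed.

Lemma neck_kind_ex i : i < 2 * L -> exists x : necklace, kind x = i.
Proof. by move=> iL; have [x []] := neck_vertex iL (sz_gt0 iL); exists x. Qed.

Lemma neck_adj_lev x y : kind y = nlev (kind x).+1 -> adj x y.
Proof.
move=> E; rewrite (adjE dP); apply/eqP.
have := level_lt x; have := nlevE (kind x).+1; rewrite -E => H kx.
by apply: neck_arc; rewrite /arcdist; lia.
Qed.

Lemma neck_adj0 x y : x != y -> kind x = 0 -> kind y = 0 -> adj x y.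
Proof.
move=> xy kx ky; rewrite (adjE dP) bdist_neq // kx ky.
by have := @ndkE L 0 0; rewrite /arcdist; lia.
Qed.

Lemma neck_edge_ind (Q : necklace -> necklace -> Prop) :
  (forall x y, Q x y -> Q y x) ->
  (forall x y, kind x = 0 -> kind y = 0 -> idx x = 0 -> idx y = 1 -> Q x y) ->
  (forall x y, kind y = nlev (kind x).+1 -> Q x y) ->
  forall x y, adj x y -> Q x y.
Proof.
move=> Qsym Q0 QS x y; rewrite (adjE dP) => /eqP xy1.
have := neck_dist x y; rewrite xy1 /arcdist.
have := level_lt x; have := level_lt y => yL xL H.
have [[kx ixy]|[E|E]] : kind x = 0 /\ kind y = 0 /\ idx x <> idx y \/
    kind y = nlev (kind x).+1 \/ kind x = nlev (kind y).+1.
- by have := nlevE (kind x).+1; have := nlevE (kind y).+1; lia.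
- have [ky ne] := ixy; have := idx_lt x; have := idx_lt y; rewrite kx ky sz0 => iy ix.
  have [[? ?]|[? ?]] : idx x = 0 /\ idx y = 1 \/ idx y = 0 /\ idx x = 1 by lia.
    exact: Q0.
  by apply: Qsym; apply: Q0.
- exact: QS.
- by apply: Qsym; apply: QS.
Qed.

Lemma neck_connected : connected_graph necklace.
Proof. exact: dist_connected dP. Qed.

Lemma neck_ends : exists x0 x1 : necklace,
  [/\ kind x0 = 0, idx x0 = 0, kind x1 = 0 & idx x1 = 1].
Proof.
have [||x0 [? ?]] := @neck_vertex 0 0; rewrite ?sz0 //; first lia.
have [||x1 [? ?]] := @neck_vertex 0 1; rewrite ?sz0 //; first lia.
by exists x0, x1.
Qed.

Lemma neck_neq x y : kind x <> kind y \/ idx x <> idx y -> x != y.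
Proof. by move=> H; apply/eqP => xy; case: H; rewrite xy. Qed.

(** Opposite single vertices: every level is on one of the two half circles. *)
Lemma neck_geodetic i : 0 < i < L -> sz i = 1 -> sz (i + L) = 1 ->
  geodetic_number necklace 2.
Proof.
move=> iL si siL.
have [|u ku] := @neck_kind_ex i; first lia.
have [|v kv] := @neck_kind_ex (i + L); first lia.
apply: min_card_le; last by move=> S; apply: geodetic_ge2; exists u.
exists [set x in [:: u; v]]; split; last exact: card_set_seq.
apply: (geodetic_setP dP) => x; exists u, v; rewrite !in_set !inE !eqxx orbT; split=> //.
  by apply: neck_neq; lia.
have xL := level_lt x.
have E : d u v = L by apply: neck_arc; rewrite /arcdist; lia.
have Eu : kind x = i -> idx u = idx x by move=> kx; apply: neck_same; rewrite ku.
have Ev : kind x = i + L -> idx x = idx v by move=> kx; apply: neck_same; rewrite kx ?kv.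
rewrite E; have := neck_dist u x; have := neck_dist x v; rewrite /arcdist ku kv.
lia.
Qed.

Lemma neck_edge_geodetic_ge S : edge_geodetic_set S -> 3 <= #|S|.
Proof.
have [x0 [x1 [k0 i0 k1 i1]]] := neck_ends; have [|p kp] := @neck_kind_ex 1; first lia.
have x01 : x0 != x1 by apply: neck_neq; lia.
apply: (@edge_geodetic_ge3 _ _ dP _ x0 x1 p); first exact: neck_adj0.
  by apply: neck_adj_lev; rewrite /nlev k1 kp; case: eqP; lia.
by apply: neck_adj_lev; rewrite /nlev k0 kp; case: eqP; lia.
Qed.

(** The two vertices of level 0 with the vertex opposite to them. *)
Lemma neck_edge_geodetic : sz L = 1 -> edge_geodetic_number necklace 3.
Proof.
move=> sL; apply: min_card_le; last exact: neck_edge_geodetic_ge.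
have [x0 [x1 [k0 i0 k1 i1]]] := neck_ends; have [|z kz] := @neck_kind_ex L; first lia.
pose S := [set x in [:: x0; x1; z]]; exists S; split; last exact: card_set_seq.
have x0S : x0 \in S by rewrite !inE eqxx.
have zS : z \in S by rewrite !inE eqxx !orbT.
have end_in x : kind x = 0 -> x \in S.
  move=> kx; have := idx_lt x; rewrite kx sz0 => ix; rewrite !inE.
  case E: (idx x) ix => [|[|]] // _.
    by have -> : x = x0; [apply: bvert_inj; rewrite ?kx ?E | rewrite eqxx].
  by have -> : x = x1; [apply: bvert_inj; rewrite ?kx ?E | rewrite eqxx orbT].
have Ez x : kind x = L -> idx x = idx z by move=> kx; apply: neck_same; rewrite kx ?kz.
apply: (edge_geodetic_setP dP); apply: neck_edge_ind => [x y [u [v [uS vS E]]]|x y kx ky ix iy|x y E].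
- exists v, u; split=> //.
  by rewrite (distC dP v y) (distC dP x u) (distC dP v u) /=; lia.
- exists x, y; rewrite !end_in // !bdistxx; split=> //; apply/esym/eqP.
  by rewrite add0n addn0 -(adjE dP) neck_adj0 //; apply: neck_neq; lia.
have [xL yL] := (level_lt x, level_lt y); have Ey := nlevE (kind x).+1; rewrite -E in Ey.
have [ltxL|lexL] := ltnP (kind x) L.
  have [u [ku uS ux]] : exists u, [/\ kind u = 0, u \in S & kind x = 0 -> idx u = idx x].
    have [kx|kx] := eqVneq (kind x) 0; first by exists x; rewrite end_in.
    by exists x0; split=> // kx'; rewrite kx' in kx.
  exists u, z; split=> //; have Ezy := Ez y.
  have -> : d u z = L by apply: neck_arc; rewrite /arcdist; lia.
  have := neck_dist u x; have := neck_dist y z; rewrite /arcdist ku kz; lia.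
have [v [kv vS yv]] : exists v, [/\ kind v = 0, v \in S & kind y = 0 -> idx v = idx y].
  have [ky|ky] := eqVneq (kind y) 0; first by exists y; rewrite end_in.
  by exists x0; split=> // ky'; rewrite ky' in ky.
exists z, v; split=> //; have Ezx := Ez x.
have -> : d z v = L by apply: neck_arc; rewrite /arcdist; lia.
have := neck_dist z x; have := neck_dist y v; rewrite /arcdist kv kz; lia.
Qed.

Lemma neck_end_in S x : edge_geodetic_set S -> kind x = 0 -> x \in S.
Proof.
move=> HS kx.
have [||y [ky iy]] := @neck_vertex 0 (1 - idx x); first lia.
  by rewrite sz0; lia.
have ixy : idx x <> idx y by have := idx_lt x; rewrite kx sz0; lia.
apply: (true_twin_in dP (y := y) _ _ HS).
  by apply: neck_adj0 => //; apply: neck_neq; right.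
move=> z zx zy; have kz : kind z != 0.
  apply: contraNneq zx => kz; apply/eqP/bvert_inj; rewrite ?kz ?kx //.
  have : idx z <> idx y by move=> izy; move/eqP: zy; apply; apply: bvert_inj; rewrite ?kz.
  by have := idx_lt z; have := idx_lt x; have := idx_lt y; rewrite kz kx ky sz0; lia.
by rewrite !bdist_kind ?kx ?ky.
Qed.

(** Both vertices of level 0 are in S, and an end x0 of level 0 has an edge to
    level 1 and one to level 2 L - 1. With only one further vertex v in S, both
    of these edges would be on the path of x0 and v, at the same distance
    from x0. *)
Lemma neck_strong_ge4 S : strong_edge_geodetic_set S -> 4 <= #|S|.
Proof.
move=> HS; have Seg := strong_edge_geodetic HS; have [P [PS PE]] := HS.
have [x0 [x1 [k0 i0 k1 i1]]] := neck_ends; have [|p kp] := @neck_kind_ex 1; first lia.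
have [|q kq] := @neck_kind_ex (2 * L).-1; first lia.
have x0S := neck_end_in Seg k0; have x1S := neck_end_in Seg k1.
have x01 : x0 != x1 by apply: neck_neq; lia.
rewrite leqNgt; apply/negP => S3.
have E2 u v : u \in S -> v \in S -> kind u <> 0 -> kind v <> 0 -> u = v.
  move=> uS vS ku kv; have : #|S :\: [set x0; x1]| <= 1.
    have := cardsID [set x0; x1] S; rewrite (setIidPr _) ?cards2 ?x01; first lia.
    by apply/subsetP => x /set2P[]->.
  have out x : kind x <> 0 -> x \notin [set x0; x1].
    by move=> kx; apply/negP => /set2P[] E; rewrite E in kx.
  by move/card_le1_eqP => H; apply: H; rewrite inE out.
have tw y : kind y <> 0 -> d x0 y = d x1 y.
  by move=> ky; rewrite !bdist_kind ?k0 ?k1 // eq_sym; apply/eqP.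
have ends u : u \in S -> kind u = 0 -> u = x0 \/ u = x1.
  move=> uS ku; have := idx_lt u; rewrite ku sz0 => iu.
  have [iu0|iu1] : idx u = 0 \/ idx u = 1 by lia.
    by left; apply: bvert_inj; rewrite ?ku ?iu0.
  by right; apply: bvert_inj; rewrite ?ku ?iu1.
have side y : adj x0 y -> kind y <> 0 ->
    exists v, [/\ v \in S, kind v <> 0 & y \in P x0 v].
  move=> xy ky; have [u [v [s1 [s2 [uS vS uvP Euv E]]]]] := strong_oriented dP PS (PE _ _ xy).
  have xy1 : d x0 y = 1 by apply/eqP; rewrite -(adjE dP).
  have x10 : d x1 x0 = 1 by apply/eqP; rewrite -(adjE dP) adj_sym neck_adj0.
  have kv : kind v <> 0 -> u = x0 -> exists v, [/\ v \in S, kind v <> 0 & y \in P x0 v].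
    by move=> kv ux; exists v; rewrite -ux Euv mem_cat !inE eqxx !orbT.
  have [ku|ku] := eqVneq (kind u) 0; have [kv0|kv0] := eqVneq (kind v) 0.
  - have y1 : d y x1 <> 0.
      by move/eqP; rewrite (dist_eq0 dP) => /eqP yx; rewrite yx in ky.
    by move: E; have [->|->] := ends u uS ku; have [->|->] := ends v vS kv0;
      rewrite ?bdistxx ?x10 ?(distC dP x0 x1) ?x10 /=; lia.
  - have [ux|ux] := ends u uS ku; first by apply: kv => //; apply/eqP.
    have := dist_triangle dP x0 y v; move: E; rewrite ux tw; last exact/eqP.
    by rewrite x10 xy1; lia.
  - move: E; have [->|->] := ends v vS kv0; first by lia.
    by rewrite (distC dP u x1) (distC dP u x0) /= tw; [lia|exact/eqP].
  - by move: E; rewrite (E2 u v uS vS (elimN eqP ku) (elimN eqP kv0)) bdistxx; lia.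
have [||v [vS kv pP]] := side p; rewrite ?kp //.
  by apply: neck_adj_lev; rewrite k0 kp /nlev; case: eqP; lia.
have [||v' [vS' kv' qP]] := side q; rewrite ?kq //; last 1 first.
- have x0v : x0 != v by apply: neck_neq; lia.
  rewrite (E2 v' v) // in qP; have [sP _] := PS x0 v x0S vS x0v.
  have : p = q; last by move=> pq; move: kp L2; rewrite pq kq; clear; lia.
  apply: (shortest_inj dP sP pP qP).
  by rewrite !(@neck_arc x0 _ 1) // ?k0 ?kp ?kq /arcdist; move: L2; clear; lia.
- by rewrite adj_sym; apply: neck_adj_lev; rewrite k0 kq /nlev; case: eqP; lia.
- by lia.
Qed.

(** A vertex in a level with at least two vertices can be replaced by another
    one of its level on the way between the two neighbouring levels. *)
Lemma neck_meg_forced S x : meg_set S -> 1 < sz (kind x) -> x \in S.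
Proof.
move=> MS sx; have Seg := strong_edge_geodetic (meg_strong dP MS).
have [kx|kx] := eqVneq (kind x) 0; first exact: neck_end_in.
have xL := level_lt x.
have [|y ky] := @neck_kind_ex (kind x).-1; first lia.
have yx : adj y x by apply: neck_adj_lev; rewrite ky /nlev; case: eqP; lia.
have [||x' [kx' ix']] := @neck_vertex (kind x) (if idx x == 0 then 1 else 0); first lia.
  by case: eqP; lia.
have xx' : x' != x by apply: neck_neq; right; rewrite ix'; case: eqP; lia.
apply: (meg_forced dP yx) MS => z xz zy yz; exists x' => //.
have tw w : w <> x -> w <> x' -> d x w = d x' w.
  move=> wx wx'; rewrite !bdist_neq ?kx' //; apply/eqP => //; exact: nesym.
have dxx' : d x x' = 2.
  by rewrite bdist_neq 1?eq_sym // kx'; have := ndkE xL xL; rewrite /arcdist; lia.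
move: yx xz; rewrite !(adjE dP) (distC dP y x) (distC dP y x') => yx xz.
have yx0 : y <> x by move=> E; move: ky; rewrite E; lia.
have yx1 : y <> x' by move=> E; move: ky; rewrite E kx'; lia.
have zx0 : z <> x by move=> E; move: xz; rewrite E bdistxx.
have zx1 : z <> x' by move=> E; move: xz; rewrite E dxx'.
by rewrite -!tw // yx xz.
Qed.

(** Two vertices less than L levels apart, with single vertices on the levels
    between them, have only one geodesic. *)
Lemma neck_monitor (al be : nat) u v x y : al <= kind x < be -> be < al + L ->
  be <= 2 * L -> kind u = al -> kind v = nlev be -> kind y = nlev (kind x).+1 ->
  (forall i, al < i < be -> sz i = 1) ->
  (kind x = al -> x = u) -> ((kind x).+1 = be -> y = v) ->
  forall s, shortest_path u v s -> edge_on x y s.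
Proof.
move=> ab abL beL ku kv kxy single xu yv.
have [xL yL] := (level_lt x, level_lt y).
have nb := nlevE be; have ny := nlevE (kind x).+1; rewrite -kxy in ny; rewrite -kv in nb.
have uv : d u v = be - al by apply: neck_arc; rewrite /arcdist; lia.
have ux : d u x = kind x - al.
  have [kx|kx] := eqVneq (kind x) al; first by rewrite xu // bdistxx; lia.
  by apply: neck_arc; rewrite /arcdist; lia.
have yv' : d y v = be - (kind x).+1.
  have [kx|kx] := eqVneq (kind x).+1 be; first by rewrite yv // bdistxx; lia.
  by apply: neck_arc; rewrite /arcdist; lia.
have xv : d x v = be - kind x by apply: neck_arc; rewrite /arcdist; lia.
have uy : d u y = (kind x).+1 - al by apply: neck_arc; rewrite /arcdist; lia.
have here z i : al <= i <= be -> d u z = i - al -> d z v = be - i -> kind z = nlev i.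
  move=> ii; have zL := level_lt z; have := neck_dist u z; have := neck_dist z v.
  move: (d u z) (d z v) => a b; rewrite /arcdist ku.
  by case: (nlevE i) => -[iL ->]; clear - ii iL nb zL abL beL ab L2; lia.
apply: (monitorP dP); first by rewrite uv ux yv'; lia.
- exact: neck_adj_lev.
- move=> z uz zv; rewrite ux in uz; rewrite yv' in zv.
  have kz : kind z = kind x.
    by rewrite (here z (kind x)) //; [rewrite /nlev; case: eqP; lia|lia|lia].
  have [kx|kx] := eqVneq (kind x) al.
    by apply/esym; rewrite xu //; apply/eqP; rewrite -(dist_eq0 dP) uz kx subnn.
  by apply: neck_single; rewrite // kz single //; lia.
- move=> z uz zv; rewrite ux in uz; rewrite yv' in zv.
  have kz : kind z = kind y.
    by rewrite (here z (kind x).+1) //; lia.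
  have [kx|kx] := eqVneq (kind x).+1 be.
    by rewrite yv //; apply/eqP; rewrite -(dist_eq0 dP) zv kx subnn.
  apply: neck_single; rewrite // kz; case: ny => [[? _]|[_ ->]]; first lia.
  by rewrite single //; lia.
Qed.

(** It is enough that each step from level i to the next one lies in a segment
    shorter than L, with ends in s and single levels inside. *)
Lemma neck_meg (s : seq nat) : 0 \in s ->
  (forall i, i < 2 * L -> exists al be, [/\ al <= i < be, be <= 2 * L, be < al + L,
     (al \in s) && (nlev be \in s) & forall l, al < l < be -> sz l = 1]) ->
  meg_set (G := necklace) [set x | kind x \in s].
Proof.
move=> s0 H; apply: neck_edge_ind => [x y [u [v [uM vM uv E]]]|x y kx ky ix iy|x y E].
- by exists u, v; split=> // t /E; rewrite edge_onC.
- have xy : x != y by apply: neck_neq; lia.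
  exists x, y; rewrite !inE kx ky s0; split=> //.
  exact: (monitor_adj dP (neck_adj0 xy kx ky)).
have [xL yL] := (level_lt x, level_lt y).
have [al [be [ab beL abL /andP[als bes] single]]] := H _ xL.
have [u [ku xu]] : exists u, kind u = al /\ (kind x = al -> x = u).
  have [kx|kx] := eqVneq (kind x) al; first by exists x.
  have [|u ku] := @neck_kind_ex al; first lia.
  by exists u; split=> // E'; rewrite E' in kx; case/eqP: kx.
have [v [kv yv]] : exists v, kind v = nlev be /\ ((kind x).+1 = be -> y = v).
  have [kx|kx] := eqVneq (kind x).+1 be; first by exists y; rewrite E kx.
  have [|v kv] := @neck_kind_ex (nlev be); first by have := nlevE be; lia.
  by exists v; split=> // E'; rewrite E' in kx; case/eqP: kx.
exists u, v; rewrite !inE ku kv als bes; split=> //.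
  by apply: neck_neq; left; rewrite ku kv; have := nlevE be; lia.
exact: (neck_monitor ab abL beL ku kv E single xu yv).
Qed.

(** Here mk i j stands for the vertex of index j in level i. The ends are given
    as vertices, because the last level can be level 0 under the name 2 L. *)
Definition route (mk : nat -> nat -> necklace) u v i0 n (r : nat -> nat) : seq necklace :=
  [seq (if i == i0 then u else if i == i0 + n then v else mk i (r i))
     | i <- iota i0 n.+1].

Section Route.
Variables (mk : nat -> nat -> necklace) (u v : necklace) (i0 n : nat) (r : nat -> nat).
Hypotheses (mkP : forall i j, i < 2 * L -> j < sz i -> kind (mk i j) = i /\ idx (mk i j) = j)
  (ku : kind u = i0) (kv : kind v = nlev (i0 + n)) (n0 : 0 < n) (nL : n <= L)
  (inL : i0 + n <= 2 * L) (rP : forall i, i0 < i < i0 + n -> r i < sz i).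

Lemma neck_route : shortest_path u v (route mk u v i0 n r).
Proof.
pose f i := if i == i0 then u else if i == i0 + n then v else mk i (r i).
have kf i : i0 <= i <= i0 + n -> kind (f i) = nlev i.
  rewrite /f /nlev => ii; case: eqP => [->|ii0]; first by rewrite ku; case: eqP; lia.
  case: eqP => [->|iin]; first by rewrite kv.
  have [|| -> _] := @mkP i (r i); [lia|apply: rP; lia|by case: eqP; lia].
have fu : f i0 = u by rewrite /f eqxx.
have fv : f (i0 + n) = v by rewrite /f eqxx; case: eqP => //; lia.
rewrite -{1}fu -{1}fv; apply: (shortest_route dP) => [i ii|].
  have ni : nlev i = i by rewrite /nlev; case: eqP; lia.
  by apply: neck_adj_lev; rewrite !kf ?ni //; lia.
rewrite fu fv; have := nlevE (i0 + n); rewrite -kv => H.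
have uL := level_lt u; rewrite ku in uL.
by apply: neck_arc; rewrite /arcdist ?ku; lia.
Qed.

Lemma neck_route_edge x y : i0 <= kind x < i0 + n -> kind y = nlev (kind x).+1 ->
  (if kind x == i0 then x = u else idx x = r (kind x)) ->
  (if (kind x).+1 == i0 + n then y = v else idx y = r (kind x).+1) ->
  edge_on x y (route mk u v i0 n r).
Proof.
move=> xi ky xE yE; have xL := level_lt x.
pose f i := if i == i0 then u else if i == i0 + n then v else mk i (r i).
have -> : x = f (kind x).
  rewrite /f; move: xE; case: eqP => // xi0 ix; case: eqP => [|_]; first lia.
  have rx : r (kind x) < sz (kind x) by apply: rP; lia.
  have [kx jx] := mkP xL rx.
  by apply: bvert_inj; rewrite ?kx ?jx.
have -> : y = f (kind x).+1.
  rewrite /f; case: eqP => [|_]; first lia; move: yE; case: eqP => // xn iy.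
  have rx : r (kind x).+1 < sz (kind x).+1 by apply: rP; lia.
  have yL : (kind x).+1 < 2 * L by lia.
  have [kx jx] := mkP yL rx; apply: bvert_inj; rewrite ?kx ?jx // ky /nlev.
  by case: eqP; lia.
exact: edge_on_route.
Qed.

End Route.

End Necklace.

(** * Pairs with c + 3 <= d <= 2 c - 4 *)

(** The necklace with four pairs of opposite levels, where level 3 has k
    vertices and level 6 has l vertices. *)
Section Bulge.
Variables k l : nat.
Hypotheses (l0 : 0 < l) (lk : l + 6 <= k).

Definition bulge_size i := if i == 0 then 2 else if i == 3 then k else if i == 6 then l else 1.

Lemma bulge_size_gt0 i : i < 2 * 4 -> 0 < bulge_size i.
Proof. by move=> _; rewrite /bulge_size; repeat case: ifP => // _; lia. Qed.

Lemma bulge_size_1 i : i <> 0 -> i <> 3 -> i <> 6 -> bulge_size i = 1.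
Proof. by rewrite /bulge_size; do 3 (case: eqP => // _). Qed.

Let L2 : 2 < 4 := isT.
Let s0 : bulge_size 0 = 2 := erefl.
Let A := necklace bulge_size L2.
Local Notation d := (@bdist (2 * 4) bulge_size (ndk 4)).
Implicit Types (x y z u v w : A) (S : {set A}).
Let dP : is_dist (G := A) d := bdist_is_dist (ndk_dist L2) bulge_size_gt0.

(** Levels 0, 3 and 6 monitor all edges. They consist of twins, except that
    level 6 may be a single vertex; in that case it is not forced, but levels 0
    and 3 alone have no geodesic through the edge from level 5 to level 6. *)
Lemma bulge_meg : meg_number A (k + l + 2).
Proof.
apply: min_card_le.
  exists [set x : A | kind x \in [:: 0; 3; 6]]; split; last first.
    rewrite card_kinds //; first by rewrite !big_cons big_nil /bulge_size /=; lia.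
    by move=> i; rewrite !inE; do ?[case/orP]; move=> /eqP->.
  apply: (neck_meg s0 bulge_size_gt0) => // i i8.
  exists (if i < 3 then 0 else if i < 6 then 3 else 6).
  exists (if i < 3 then 3 else if i < 6 then 6 else 8).
  have [i3|i3] := ltnP i 3; last have [i6|i6] := ltnP i 6.
  - by split=> // j j3; apply: bulge_size_1; lia.
  - by split=> //; [lia.. |move=> j j3; apply: bulge_size_1; lia].
  - by split=> //; [lia.. |move=> j j3; apply: bulge_size_1; lia].
move=> S MS.
have forced i x : kind x = i -> 1 < bulge_size i -> x \in S.
  by move=> <-; exact: (neck_meg_forced s0 bulge_size_gt0 MS).
have [l1|l1] := ltnP 1 l.
  have -> : k + l + 2 = \sum_(i <- [:: 0; 3; 6]) bulge_size i.
    by rewrite !big_cons big_nil /bulge_size /=; lia.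
  apply: card_kinds_le => // [i|x].
    by rewrite !inE; do ?[case/orP]; move=> /eqP->.
  by rewrite !inE; do ?[case/orP]; move=> /eqP kx; apply: (forced _ x kx);
    rewrite /bulge_size //=; lia.
suff [s sS ks] : exists2 s, s \in S & kind s \notin [:: 0; 3].
  have : \sum_(i <- [:: 0; 3]) bulge_size i <= #|S :\ s|.
    apply: card_kinds_le => // [i|x kx].
      by rewrite !inE; do ?[case/orP]; move=> /eqP->.
    rewrite !inE; have -> : x != s by apply: contraNneq ks => <-.
    by move: kx; rewrite !inE => /orP[] /eqP kx; apply: (forced _ x kx); rewrite /bulge_size //=; lia.
  by rewrite (cardsD1 s S) sS !big_cons big_nil /bulge_size /=; lia.
have [|a ka] := neck_kind_ex L2 bulge_size_gt0 (i := 5); first by [].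
have [|b kb] := neck_kind_ex L2 bulge_size_gt0 (i := 6); first by [].
have ab : @adj A a b by apply: (neck_adj_lev s0 bulge_size_gt0); rewrite ka kb.
have [u [v [uS vS E]]] := edge_geodetic_dist dP
  (strong_edge_geodetic (meg_strong dP MS)) ab.
apply/exists_inP; apply: contraT; rewrite negb_exists_in => /forall_inP SM.
have {}SM s : s \in S -> kind s = 0 \/ kind s = 3.
  by move/SM; rewrite negbK !inE => /orP[] /eqP; [left|right].
have := neck_dist u v; have := neck_dist u a.
have := neck_dist b v; rewrite /arcdist ka kb.
have := SM u uS; have := SM v vS; move: E; clear; lia.
Qed.

(** The edge from level 2 to a vertex w of level 3 outside of S is on the path
    of a pair of ends in the levels 0 to 2 and 4 to 6, at most four levels
    apart, and such a path has only one vertex on level 3. The number of pairs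
    of this kind is at most the number of vertices which S has outside of
    level 3. *)
Lemma bulge_strong_ge S : strong_edge_geodetic_set S -> k <= #|S|.
Proof.
move=> HS; have Seg := strong_edge_geodetic HS; have [P [PS PE]] := HS.
pose K i := [set x in S | kind x == i].
pose C i := [set x : A | (kind x == i) && (x \notin S)].
have KC i : i < 8 -> #|K i| + #|C i| = bulge_size i by exact: card_kind_split.
have C0 : #|C 0| = 0.
  apply: eq_card0 => x; rewrite !inE; apply/negP => /andP[/eqP kx].
  by rewrite (neck_end_in s0 bulge_size_gt0 Seg kx).
have [|c kc] := neck_kind_ex L2 bulge_size_gt0 (i := 2); first by [].
pose B := setX (K 0) (K 4) :|: setX (K 1) (K 4 :|: K 5) :|:
          setX (K 2) (K 4 :|: K 5 :|: K 6).
have CB : #|C 3| <= #|B|.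
  apply: (card_le_rel (R := fun (x : A) (y : A * A) => shortest_path y.1 y.2 (P y.1 y.2) /\
    x \in P y.1 y.2 /\ kind y.1 < 3)) => [x|x x' [u v]].
    rewrite !inE => /andP[/eqP kx xS].
    have cx : adj c x by apply: (neck_adj_lev s0 bulge_size_gt0); rewrite kc kx.
    have [u [v [s1 [s2 [uS vS uvP Puv E]]]]] := strong_oriented dP PS (PE _ _ cx).
    have ux : kind u = 3 -> idx u <> idx x.
      by move=> ku iu; move: xS; rewrite -(bvert_inj _ iu) ?uS ?ku.
    have vx : kind v = 3 -> idx x <> idx v.
      by move=> kv iv; move: xS; rewrite (bvert_inj _ iv) ?vS ?kv.
    have vc : kind v = 2 -> idx v = idx c.
      by move=> kv; apply: (neck_same (L2 := L2) s0); rewrite kv ?kc.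
    have [H1 H2] : kind u < 3 /\ (4 <= kind v <= 6) && (kind v <= kind u + 4).
      have := neck_dist u v; have := neck_dist u c; have := neck_dist x v; rewrite /arcdist kc kx.
      move: (kind_lt u) (kind_lt v) ux vx vc E; clear => uL vL ux vx vc E.
      case=> [?|[?|[_ [xv0 [xvL xv]]]]]; case=> [?|[?|[_ [uc0 [ucL uc]]]]]; lia.
    exists (u, v); last first.
      by split=> //; split=> //=; rewrite Puv mem_cat !inE eqxx !orbT.
    by rewrite !inE uS vS /=; move: H1 H2; clear; lia.
  rewrite !inE => /andP[/eqP kx _] /andP[/eqP kx' _] /= [uvP [xP ku]] [_ [xP' _]].
  by apply: (shortest_inj dP uvP xP xP'); rewrite !bdist_kind ?kx ?kx' //; lia.
have BS : #|B| <= #|K 0| * #|K 4| + #|K 1| * (#|K 4| + #|K 5|) +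
    #|K 2| * (#|K 4| + #|K 5| + #|K 6|).
  have U (T : finType) (X Y : {set T}) : #|X :|: Y| <= #|X| + #|Y|.
    by rewrite cardsU leq_subr.
  have U3 := leq_trans (U _ (K 4 :|: K 5) (K 6)) (leq_add (U _ (K 4) (K 5)) (leqnn _)).
  rewrite /B; apply: leq_trans (U _ _ _) _; apply: leq_add; last first.
    by rewrite cardsX leq_mul2l U3 orbT.
  apply: leq_trans (U _ _ _) _; apply: leq_add; first by rewrite cardsX.
  by rewrite cardsX leq_mul2l U orbT.
rewrite (card_by_kind S) -(big_mkord xpredT (fun i => #|K i|)) unlock /=.
have := KC 0 isT; have := KC 1 isT; have := KC 2 isT; have := KC 3 isT.
have := KC 4 isT; have := KC 5 isT; rewrite C0 /bulge_size /= addn0.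
move: CB BS.
move: #|K 0| #|K 1| #|K 2| #|K 3| #|K 4| #|K 5| #|K 6| #|K 7| => k0 k1 k2 k3 k4 k5 k6 k7.
move: #|C 1| #|C 2| #|C 3| #|C 4| #|C 5| #|B| => c1 c2 c3 c4 c5 b; clear.
move=> cb bs K5 K4 K3 K2 K1 K0.
have {}K0 : k0 = 2 by []; subst k0.
have [?|?] : k1 = 0 \/ k1 = 1 by lia.
all: have [?|?] : k2 = 0 \/ k2 = 1 by lia.
all: have [?|?] : k4 = 0 \/ k4 = 1 by lia.
all: have [?|?] : k5 = 0 \/ k5 = 1 by lia.
all: subst; lia.
Qed.

(** Conversely, all the pairs in question can be used when S contains the
    levels 0, 1, 2, 4, 5 and 6. There are l + 6 of them: l from level 2 to
    level 6, one each for the levels (2,4), (2,5), (1,4), (1,5), and two for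
    (0,4). So S needs only the vertices of level 3 from index l + 6 on, and its
    size is (l + 6) + (k - (l + 6)). *)
Lemma bulge_strong_le : exists S, strong_edge_geodetic_set S /\ #|S| <= k.
Proof.
have [|mk mkP] := @bvert_mk (2 * 4) bulge_size isT; first by [].
pose S := [set x : A | (kind x \in [:: 0; 1; 2; 4; 5; 6]) || (kind x == 3) && (l + 6 <= idx x)].
exists S; split; last first.
  have := cardsU [set x : A | kind x \in [:: 0; 1; 2; 4; 5; 6]]
    [set x : A | (kind x == 3) && (l + 6 <= idx x)].
  rewrite card_kinds //; last by move=> i; rewrite !inE; clear; lia.
  rewrite (@card_tail (2 * 4) bulge_size 3 (l + 6) isT) !big_cons big_nil /= => E.
  have -> : #|S| = #|[set x : A | kind x \in [:: 0; 1; 2; 4; 5; 6]] :|: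
      [set x : A | (kind x == 3) && (l + 6 <= idx x)]|.
    by apply: eq_card => x; rewrite !inE.
  by rewrite E /bulge_size /=; move: lk; clear; lia.
have inS x : kind x <> 3 -> kind x <> 7 -> x \in S.
  by rewrite !inE; have := kind_lt x; clear; lia.
pose top v := if kind v == 0 then 8 else kind v.
have topE v : kind v = 0 /\ top v = 8 \/ kind v <> 0 /\ top v = kind v.
  by rewrite /top; case: eqP; [left|right].
(* A pair four levels apart can be joined on either side; going upwards is
   excluded when it starts on level 4, so that every pair has one path. *)
pose up u v := (kind u < top v <= kind u + 4) && (kind v + 4 != kind u).
(* The vertex of level 3 on the path from u to v: the pairs listed above are
   sent bijectively to the indices below l + 6. *)
pose w u v := if kind v == 6 then idx v else
  l + (2 - kind u) * 2 + (if kind u == 0 then idx u else kind v - 4).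
pose r u v i := if i == 3 then w u v else 0.
pose Q u v := if up u v then route mk u v (kind u) (top v - kind u) (r u v)
  else if [&& kind u == 0, kind v == 0 & idx u < idx v] then [:: u; v] else [::].
have rP u v : up u v -> forall i, kind u < i < kind u + (top v - kind u) -> r u v i < bulge_size i.
  move=> uv i ui; rewrite /r; case: eqP => [->|i3]; last first.
    apply: bulge_size_gt0; have := topE v; have := kind_lt v.
    by move: uv ui; rewrite /up; clear; lia.
  have iu : kind u = 0 -> idx u < 2 by move=> ku; have := idx_lt u; rewrite ku.
  have iv : kind v = 6 -> idx v < l by move=> kv; have := idx_lt v; rewrite kv.
  have := topE v; have := kind_lt v; rewrite /w -[bulge_size 3]/k.
  move: uv ui iu iv lk l0; rewrite /up; clear; case: (eqVneq (kind v) 6); case: (eqVneq (kind u) 0); lia.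
apply: (strong_setP dP (Q := Q)) => [u v uS vS uv|].
  rewrite /Q; case: ifP => [H _|H].
    have [T U] := (topE u, topE v); split.
      apply: (neck_route s0 bulge_size_gt0 mkP) (rP _ _ H) => //.
      + have := nlevE 4 (kind u + (top v - kind u)); move: U H (kind_lt v).
        by rewrite /up; clear; lia.
      + by move: H; rewrite /up; clear; lia.
      + by move: H; rewrite /up; clear; lia.
      + by move: U H (kind_lt v); rewrite /up; clear; lia.
    have -> : up v u = false.
      by move: T U H (kind_lt v) (kind_lt u); rewrite /up; clear; lia.
    by rewrite andbCA; case: ifP => // /and3P[/eqP v0 /eqP u0 _]; move: U H; rewrite /up; clear - v0 u0; lia.
  case: ifP => // /and3P[/eqP ku /eqP kv iuv] _; rewrite /up ku kv; split.
    by apply: (shortest1 dP); apply: (neck_adj0 s0 bulge_size_gt0).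
  have := topE u; rewrite ku => T; case: ifP; first by move: T; clear; lia.
  by case: ifP => // /and3P[_ _]; move: iuv; clear; lia.
have good i : i < l + 6 -> exists u v, [/\ u \in S, v \in S, u != v &
    up u v /\ kind u < 3 /\ 3 < kind v /\ w u v = i].
  have H a ia b ib : a < 3 -> 3 < b <= 6 -> b <= a + 4 -> ia < bulge_size a -> ib < bulge_size b ->
      (if b == 6 then ib else l + (2 - a) * 2 + (if a == 0 then ia else b - 4)) = i ->
      exists u v, [/\ u \in S, v \in S, u != v &
        up u v /\ kind u < 3 /\ 3 < kind v /\ w u v = i].
    move=> a3 b36 ba ia_ ib_ Ei; have [|ka ja] := mkP a ia _ ia_; first by lia.
    have [|kb jb] := mkP b ib _ ib_; first by lia.
    exists (mk a ia), (mk b ib); rewrite !inS ?ka ?kb; try (move: a3 b36; clear; lia).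
    rewrite /up /top /w ka kb ja jb; split=> //; first by apply: neck_neq; left; lia.
    by split; [move: a3 b36 ba; clear; case: eqP; lia|split=> //; split=> //; lia].
  move=> il; have [il'|li] := ltnP i l; first by apply: (H 2 0 6 i).
  have [|[|[|[|[|]]]]] : i = l \/ i = l + 1 \/ i = l + 2 \/ i = l + 3 \/ i = l + 4 \/ i = l + 5.
  - by lia.
  - by move=> Ei; apply: (H 2 0 4 0) => //=; lia.
  - by move=> Ei; apply: (H 2 0 5 0) => //=; lia.
  - by move=> Ei; apply: (H 1 0 4 0) => //=; lia.
  - by move=> Ei; apply: (H 1 0 5 0) => //=; lia.
  - by move=> Ei; apply: (H 0 0 4 0) => //=; lia.
  - by move=> Ei; apply: (H 0 1 4 0) => //=; lia.
apply: (neck_edge_ind s0 bulge_size_gt0) => [x y [u [v [uS vS uv E]]]|x y kx ky ix iy|x y E].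
- by exists u, v; split=> //; rewrite edge_onC.
- exists x, y; rewrite !inS ?kx ?ky // /Q; split=> //; first by apply: neck_neq; lia.
  case: ifP => [|_]; first by have := topE y; rewrite /up kx ky; clear; lia.
  by rewrite kx ky ix iy /= /edge_on /= !inE !eqxx.
have edge u v : u \in S -> v \in S -> up u v -> kind u <= kind x < top v ->
    (if kind x == kind u then x = u else idx x = r u v (kind x)) ->
    (if (kind x).+1 == top v then y = v else idx y = r u v (kind x).+1) ->
    exists u v, [/\ u \in S, v \in S, u != v & edge_on x y (Q u v)].
  move=> uS vS uv ux xE yE; have U := topE v; exists u, v; split=> //.
    by apply: neck_neq; left; move: uv U; rewrite /up; clear; lia.
  rewrite /Q uv.
  have tv : kind u + (top v - kind u) = top v by move: uv; rewrite /up; clear; lia.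
  apply: (neck_route_edge s0 mkP); rewrite ?tv //; last by move=> i; rewrite -{1}tv; apply: rP.
  - by have := nlevE 4 (top v); move: (kind_lt v) uv U; rewrite /up; clear; lia.
  - by move: ux; clear; lia.
  - by move: uv; rewrite /up; clear; lia.
  - by move: U (kind_lt v); clear; lia.
have [xL yL] := (kind_lt x, kind_lt y); have ny := nlevE 4 (kind x).+1; rewrite -E in ny.
have ty : top y = (kind x).+1 by have := topE y; move: ny xL; clear; lia.
have direct : x \in S -> y \in S -> exists u v, [/\ u \in S, v \in S, u != v & edge_on x y (Q u v)].
  move=> xS yS; apply: (edge x y) => //; rewrite ?ty ?eqxx //; last lia.
  by have := topE y; rewrite /up ty; move: ny xL; clear; lia.
have via z i : i < l + 6 -> (kind x = 2 /\ z = y \/ kind x = 3 /\ z = x) -> idx z = i ->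
    exists u v, [/\ u \in S, v \in S, u != v & edge_on x y (Q u v)].
  move=> il xz iz; have [u [v [uS vS uv [H [u3 [v3 wi]]]]]] := good i il.
  have T := topE v; have kx23 : kind x = 2 \/ kind x = 3 by case: xz => -[]; [left|right].
  apply: (edge u v) => //; first by move: kx23 T u3 v3 (kind_lt v); clear; lia.
    rewrite /r wi; case: (eqVneq (kind x) (kind u)) => kxu.
      by apply: (neck_single s0); rewrite // (_ : kind x = 2) //; move: kx23 kxu u3; clear; lia.
    case: xz => -[kx Ez]; rewrite kx /= -?iz ?Ez //.
    by have := idx_lt x; rewrite kx /bulge_size /=; lia.
  rewrite /r wi; case: (eqVneq (kind x).+1 (top v)) => kxu.
    by apply: (neck_single s0); rewrite (_ : kind y = 4) //; move: ny kx23 kxu T v3; clear; lia.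
  case: xz => -[kx Ez]; rewrite kx /= -?iz ?Ez //.
  have := idx_lt y; have -> : kind y = 4 by lia.
  by rewrite /bulge_size /=; lia.
have [x2|x2] := eqVneq (kind x) 2.
  have [iy|iy] := ltnP (idx y) (l + 6); first by apply: (via y _ iy) => //; left.
  by apply: direct; [apply: inS; rewrite x2 | rewrite inE orbC iy andbT; lia].
have [x3|x3] := eqVneq (kind x) 3.
  have [iy|iy] := ltnP (idx x) (l + 6); first by apply: (via x _ iy) => //; right.
  by apply: direct; [rewrite inE orbC iy x3 | apply: inS; lia].
have [x6|x6] := eqVneq (kind x) 6.
  have [|kv jv] := mkP 0 0 isT; first by [].
  apply: (edge x (mk 0 0)); rewrite /up /top ?kv ?x6 ?inS ?kv ?x6 //=.
  by have := idx_lt y; rewrite /r /= (_ : kind y = 7); [rewrite /bulge_size /=; lia | lia].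
have [x7|x7] := eqVneq (kind x) 7.
  have [|ku ju] := mkP 6 0 isT; first by [].
  apply: (edge (mk 6 0) y); rewrite ?ty ?inS ?ku ?x7 //=.
  - lia.
  - lia.
  - by rewrite /up ku ty x7; clear - ny x7; lia.
  - by have := idx_lt x; rewrite /r x7 /bulge_size /=; lia.
by apply: direct; apply: inS; lia.
Qed.

Lemma bulge_realizes : realizes k (k + l + 2).
Proof.
exists A; split; first exact: (neck_connected bulge_size_gt0).
split; first exact: (neck_geodetic L2 s0 bulge_size_gt0 (i := 1)).
split; first exact: (neck_edge_geodetic L2 s0 bulge_size_gt0).
split; last exact: bulge_meg.
by apply: min_card_le; [exact: bulge_strong_le|exact: bulge_strong_ge].
Qed.

End Bulge.

(** * Pairs with d >= 2 c - 3, and c = 4 *)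

(** The count behind the lower bound for seg below: x and y are the numbers of
    vertices missing from two levels of size a, each pair of missing vertices
    needs a path of its own, and l and r are the numbers of possible ends on
    the two sides. If l + r were smaller than x + y + 3 - a, then both x and y
    would be at least l + r - 2, which is too large for the product of l and r
    as soon as l > 2; for l = 2 the strict inequality makes up for it. *)
Lemma count_ineq a x y l r : x <= a -> y <= a -> 1 < a -> 1 < l -> x * y <= l * r ->
  (l = 2 -> x * y < l * r) -> x + y + 3 <= l + r + a.
Proof.
move=> xa ya a1 l1 le lt.
have [l2|l2] := eqVneq l 2.
  have {}lt := lt l2; subst l; clear le.
  have [?|[?|?]] : x = 0 \/ x = 1 \/ 1 < x by lia.
  - by subst; lia.
  - by subst; lia.
  have [?|[?|?]] : y = 0 \/ y = 1 \/ 1 < y by lia.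
  - by subst; lia.
  - by subst; lia.
  nia.
rewrite leqNgt; apply/negP => H.
have [xs ys] : l + r <= x + 2 /\ l + r <= y + 2 by lia.
have [?|l4] := leqP (l + r) 4.
  have [[? ?]|[[? ?]|[? ?]]] : l = 3 /\ r = 0 \/ l = 3 /\ r = 1 \/ l = 4 /\ r = 0 by lia.
  - by subst; nia.
  - by subst; nia.
  - by subst; nia.
nia.
Qed.

Section Comb.
Variables n m e : nat.
Hypotheses (n0 : 0 < n) (e1 : e <= 1) (me : 0 < m + e).

(** Half the number of levels. The chain of two-vertex levels takes up every
    second level, the last of them four steps before level 0. For e = 0 it
    begins right after level L. For e = 1 four more levels are put in between
    the opposite level L and the chain, and one more vertex is needed to
    monitor the edges there; this adjusts the parity of meg. *)
Definition comb_len := 2 * m + 3 + 4 * e.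
Local Notation L := comb_len.

Definition chain i := [&& ~~ odd i, 2 * L <= i + 2 * m + 2 & i + 4 <= 2 * L].
Definition comb_size i := if i == 0 then 2 else if i == 2 then maxn 2 n else
  if i == 3 then n else if chain i then 2 else 1.

Lemma comb_len_odd : odd L. Proof. by rewrite /comb_len; lia. Qed.
Lemma comb_len_ge : 4 < L. Proof. by rewrite /comb_len; lia. Qed.

Lemma chain_lt i : chain i -> L < i /\ i + 4 <= 2 * L.
Proof. by rewrite /chain /comb_len; lia. Qed.

Lemma chain_far i : e = 1 -> chain i -> L + 5 <= i.
Proof. by move=> e_1; rewrite /chain /comb_len e_1; lia. Qed.

Lemma comb_size_gt0 i : i < 2 * L -> 0 < comb_size i.
Proof. by move=> _; rewrite /comb_size; repeat case: ifP => // _; lia. Qed.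

Lemma comb_size_1 i : i <> 0 -> i <> 2 -> (i = 3 -> n = 1) -> ~~ chain i -> comb_size i = 1.
Proof.
by rewrite /comb_size; do 2 (case: eqP => // _); case: eqP => [_ _ _ ->//|_ _ _ _ /negPf->].
Qed.

Lemma comb_size_chain i : chain i -> comb_size i = 2.
Proof. by move=> ci; have := chain_lt ci; have := comb_len_ge; rewrite /comb_size ci; do 3 (case: eqP => [|_]; first lia). Qed.

Let L2 : 2 < L. Proof. by have := comb_len_ge; lia. Qed.
Let s0 : comb_size 0 = 2 := erefl.
Let F := necklace comb_size L2.
Local Notation d := (@bdist (2 * L) comb_size (ndk L)).
Implicit Types (x y z u v w : F) (S : {set F}).
Let dP : is_dist (G := F) d := bdist_is_dist (ndk_dist L2) comb_size_gt0.

(** The levels with at least two vertices. *)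
Let s1 : seq nat := [:: 0; 2] ++ (if 1 < n then [:: 3] else [::]) ++
  [seq 2 * L - 4 - 2 * t | t <- iota 0 m].

Lemma mem_s1 i : (i \in s1) = [|| i == 0, i == 2, (1 < n) && (i == 3) | chain i].
Proof.
rewrite /s1 !mem_cat !inE -!orbA; congr [|| _, _, _ | _]; first by case: ifP; rewrite ?inE.
apply/mapP/idP => [[t]|ci].
  by rewrite mem_iota /chain => tm ->; have := comb_len_ge; rewrite /comb_len; lia.
exists ((2 * L - 4 - i)./2); last by move: ci; rewrite /chain; lia.
by rewrite mem_iota; move: ci; rewrite /chain; lia.
Qed.

Lemma uniq_s1 : uniq s1.
Proof.
have far j : j <= 3 -> j \notin [seq 2 * L - 4 - 2 * t | t <- iota 0 m].
  by move=> j3; apply/mapP => -[t]; rewrite mem_iota /comb_len; move: j3; clear; lia.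
have U : uniq [seq 2 * L - 4 - 2 * t | t <- iota 0 m].
  rewrite map_inj_in_uniq ?iota_uniq // => t t'; rewrite !mem_iota /comb_len; lia.
by rewrite /s1; case: ifP => _ /=; rewrite !inE ?negb_or ?far ?U.
Qed.

Lemma sum_s1 : \sum_(i <- s1) comb_size i = 2 + maxn 2 n + (if 1 < n then n else 0) + 2 * m.
Proof.
have chains : \sum_(t <- iota 0 m) comb_size (2 * L - 4 - 2 * t) = 2 * m.
  rewrite (eq_big_seq (fun=> 2)) => [|t]; last first.
    by rewrite mem_iota => tm; apply: comb_size_chain; rewrite /chain /comb_len; move: tm; clear; lia.
  by rewrite big_const_seq count_predT size_iota iter_addn_0.
rewrite /s1 !big_cat !big_cons big_nil /= big_map chains {1 2}/comb_size /=.
by case: ifP; rewrite ?big_cons !big_nil /comb_size /=; lia.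
Qed.

(** All the levels with at least two vertices, and for e = 1 the vertex of
    level L + 1: this cuts the circle into segments which are short enough to
    have only one geodesic. For e = 1 the edge from level L to level L + 1 is
    too far from all the twins to be on a geodesic between them. *)
Lemma comb_meg : meg_number F (2 + maxn 2 n + (if 1 < n then n else 0) + 2 * m + e).
Proof.
rewrite -sum_s1.
have s1_lt i : i \in s1 -> i < 2 * L.
  by rewrite mem_s1 /chain => H; have := comb_len_ge; move: H; clear; lia.
have e_chain : e = 1 -> ~~ chain L.+1 by move=> e_1; rewrite /chain /comb_len e_1; clear; lia.
have chain_e : e = 0 -> chain L.+1 by move=> e_0; move: me; rewrite /chain /comb_len e_0; clear; lia.
pose s := if e == 1 then L.+1 :: s1 else s1.
have mem_s i : (i \in s) = ((i == L.+1) || (i \in s1)).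
  rewrite /s; case: eqP => [_|ne]; first by rewrite inE.
  have [->|//] := eqVneq i L.+1; rewrite mem_s1 chain_e ?orbT //; lia.
apply: min_card_le.
  exists [set x : F | kind x \in s]; split; last first.
    rewrite card_kinds => [||i].
    - rewrite /s; case: eqP => [e_1|ne]; last by rewrite leq_addr.
      rewrite big_cons comb_size_1 ?e_chain // ?e_1 ?addn1 //; have := comb_len_ge; lia.
    - rewrite /s; case: eqP => [e_1|ne]; last exact: uniq_s1.
      rewrite cons_uniq uniq_s1 andbT.
      by rewrite mem_s1 (negPf (e_chain e_1)); have := comb_len_ge; clear; lia.
    - by rewrite mem_s => /orP[/eqP->|/s1_lt//]; have := L2; clear; lia.
  have memK i : i = 0 \/ i = 2 \/ i = 3 /\ 1 < n \/ i = L.+1 \/ chain i -> i \in s.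
    by rewrite mem_s mem_s1; clear; lia.
  apply: (neck_meg s0 comb_size_gt0) => [|i iL]; first by apply: memK; left.
  (* the levels at which a segment may end *)
  pose G j := j = 0 \/ j = 2 \/ j = 3 /\ 1 < n \/ j = L.+1 \/ chain j.
  have W al be : al <= i < be -> be <= 2 * L -> be < al + L ->
      G al -> be = 2 * L \/ be < 2 * L /\ G be ->
      (forall j, al < j < be -> j <> 2 /\ (j = 3 -> n = 1) /\ ~~ chain j) ->
      exists al be, [/\ al <= i < be, be <= 2 * L, be < al + L,
        (al \in s) && (nlev L be \in s) & forall j, al < j < be -> comb_size j = 1].
    move=> H1 H2 H3 Ga Gb H; exists al, be; split=> //.
      rewrite memK // /nlev; case: eqP Gb => [_ _|ne [//|[_ Gb]]]; first by apply: memK; left.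
      exact: memK.
    by move=> j jj; have [? [? ?]] := H j jj; apply: comb_size_1 => // j0; move: jj; rewrite j0.
  have c0 j : j <= L -> ~~ chain j.
    by move=> jL; apply/negP => /chain_lt; move: jL; clear; lia.
  have Lge := comb_len_ge.
  have [i2|i2] := ltnP i 2.
    apply: (W 0 2); rewrite /G; [lia..|]; move=> j jj.
    by rewrite c0; [split; lia | lia].
  have [iL'|Li] := leqP i L.
    have [n1|n1] := leqP n 1.
      apply: (W 2 L.+1); rewrite /G; [lia..|]; move=> j jj.
      by rewrite c0; [split; lia | lia].
    have [i2'|i2'] := eqVneq i 2.
      by apply: (W 2 3); rewrite /G; lia.
    apply: (W 3 L.+1); rewrite /G; [lia..|]; move=> j jj.
    by rewrite c0; [split; lia | lia].
  have Lm : L = 2 * m + 3 + 4 * e := erefl.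
  have chainI j : chain j <-> ~~ odd j /\ 2 * L <= j + 2 * m + 2 /\ j + 4 <= 2 * L.
    by rewrite /chain; clear; lia.
  have nc j : L < j -> odd j || (j + 4 > 2 * L) || (j + 2 * m + 2 < 2 * L) ->
      j <> 2 /\ (j = 3 -> n = 1) /\ ~~ chain j.
    move=> Lj; have : j <> 2 /\ j <> 3 by move: Lj Lge; clear; lia.
    by rewrite /chain; move: (odd j) => o; clear; lia.
  have [m0|m0] := posnP m.
    apply: (W L.+1 (2 * L)); rewrite /G; [lia..|]; move=> j jj.
    by apply: nc; move: jj; clear - m0; lia.
  have [i4|i4] := leqP (2 * L) (i + 4).
    apply: (W (2 * L - 4) (2 * L)); rewrite /G; [lia..| | |].
    - by move: Lm Lge m0; rewrite chainI; clear; lia.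
    - by left.
    - by move=> j jj; apply: nc; move: jj Lge; clear; lia.
  have [im|im] := ltnP (i + 2 * m + 2) (2 * L).
    apply: (W L.+1 (2 * L - 2 * m - 2)); rewrite /G; [lia..| | |].
    - by lia.
    - by right; rewrite chainI; move: im Li Lge m0; clear; lia.
    - by move=> j jj; apply: nc; move: jj; clear; lia.
  case oi : (odd i).
    apply: (W i.-1 i.+1); rewrite /G; [lia..| | |].
    - by rewrite chainI; move: oi im i4 Lm; clear; lia.
    - by right; rewrite chainI; move: oi im i4 Lm; clear; lia.
    - by move=> j jj; apply: nc; [lia|]; rewrite (_ : j = i) ?oi //; lia.
  apply: (W i i.+2); rewrite /G; [lia..| | |].
  - by rewrite chainI; move: oi im i4 Lm; clear; lia.
  - by right; rewrite chainI; move: oi im i4 Lm; clear; lia.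
  - by move=> j jj; apply: nc; [lia|]; rewrite (_ : j = i.+1) ?oddS ?oi //; lia.
move=> S MS.
have forced x : kind x \in s1 -> x \in S.
  move=> kx; apply: (neck_meg_forced s0 comb_size_gt0 MS); move: kx; rewrite mem_s1 => kx.
  rewrite /comb_size; case: eqP => // x0; case: eqP => [_|x2]; first by rewrite leq_maxl.
  case: eqP => [x3|x3]; first by move: kx; rewrite x3 /= /chain; lia.
  by case/or4P: kx => [/eqP|/eqP|/andP[_ /eqP]|->].
have S1 := card_kinds_le uniq_s1 s1_lt forced.
have [e_0|e_1] : e = 0 \/ e = 1 by move: e1; clear; lia.
  by rewrite e_0 addn0.
suff [x xS kx] : exists2 x, x \in S & kind x \notin s1.
  have : \sum_(i <- s1) comb_size i <= #|S :\ x|.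
    apply: card_kinds_le => // [|y ky]; first exact: uniq_s1.
    by rewrite !inE forced // andbT; apply: contraNneq kx => <-.
  by rewrite (cardsD1 x S) xS e_1; clear; lia.
have [|a ka] := neck_kind_ex L2 comb_size_gt0 (i := L); first by have := L2; clear; lia.
have [|b kb] := neck_kind_ex L2 comb_size_gt0 (i := L.+1); first by have := L2; clear; lia.
have ab : @adj F a b.
  by apply: (neck_adj_lev s0 comb_size_gt0); rewrite ka kb /nlev; have := L2; clear; case: eqP; lia.
have [u [v [uS vS E]]] := edge_geodetic_dist dP
  (strong_edge_geodetic (meg_strong dP MS)) ab.
apply/exists_inP; apply: contraT; rewrite negb_exists_in => /forall_inP SM.
have {}SM x : x \in S -> kind x <= 3 \/ L + 5 <= kind x.
  move/SM; rewrite negbK mem_s1 => kx; have := chain_far e_1 (i := kind x).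
  by move: kx; clear; lia.
have := neck_dist u v; have := neck_dist u a; have := neck_dist b v; rewrite /arcdist ka kb.
move: (SM u uS) (SM v vS) (kind_lt u) (kind_lt v) comb_len_ge E; clear; lia.
Qed.

(** An edge ab between vertices a of level 2 and b of level 3 outside of S is
    covered by the path of a pair of vertices of S on other levels, one nearer
    to level 2 (Low) and one nearer to level 3 (High); the path determines a
    and b. This gives the inequality of [count_ineq]. If Low has only the two
    vertices x0 and x1 of level 0, then the edge which leaves x0 backwards
    shows that some pair of Low and High has a path that avoids level 2, so the
    inequality is strict. *)
Lemma comb_strong_ge S : strong_edge_geodetic_set S -> n + 3 <= #|S|.
Proof.
move=> HS; have [n1|n2] := leqP n 1; first by apply: leq_trans (neck_strong_ge4 s0 comb_size_gt0 HS); lia.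
have Seg := strong_edge_geodetic HS; have [P [PS PE]] := HS.
have L5 := comb_len_ge.
have [x0 [x1 [k0 i0 k1 i1]]] := neck_ends L2 s0.
have x0S := neck_end_in s0 comb_size_gt0 Seg k0; have x1S := neck_end_in s0 comb_size_gt0 Seg k1.
have [|q kq] := neck_kind_ex L2 comb_size_gt0 (i := (2 * L).-1); first by lia.
have [|a0 ka0] := neck_kind_ex L2 comb_size_gt0 (i := 2); first by lia.
have [|b0 kb0] := neck_kind_ex L2 comb_size_gt0 (i := 3); first by lia.
pose K i := [set x in S | kind x == i].
pose C i := [set x : F | (kind x == i) && (x \notin S)].
have KC i : i < 2 * L -> #|K i| + #|C i| = comb_size i by exact: card_kind_split.
pose R := [set u in S | (kind u != 2) && (kind u != 3)].
pose Low := [set u in R | d u a0 < d u b0].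
pose High := [set u in R | d u b0 < d u a0].
have pass (D : {set F * F}) :
    (forall u v x, (u, v) \in D -> kind x = 2 -> x \notin P u v) ->
    #|C 2| * #|C 3| <= #|setX Low High :\: D|.
  move=> HD; rewrite -cardsX.
  apply: (card_le_rel (R := fun (p p' : F * F) => [/\ shortest_path p'.1 p'.2 (P p'.1 p'.2),
    p.1 \in P p'.1 p'.2, p.2 \in P p'.1 p'.2, p'.1 \in R & p'.2 \in R])).
    move=> [a b]; rewrite !inE /= => /andP[/andP[/eqP ka aS] /andP[/eqP kb bS]].
    have ab : adj a b.
      by apply: (neck_adj_lev s0 comb_size_gt0); rewrite ka kb /nlev; case: eqP; lia.
    have [u [v [t1 [t2 [uS vS uvP Puv E]]]]] := strong_oriented dP PS (PE _ _ ab).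
    have ua : kind u = 2 -> idx u <> idx a.
      by move=> ku iu; move: aS; rewrite -(bvert_inj _ iu) ?uS ?ku.
    have va : kind v = 2 -> idx v <> idx a.
      by move=> kv iv; move: aS; rewrite -(bvert_inj _ iv) ?vS ?kv.
    have ub : kind u = 3 -> idx u <> idx b.
      by move=> ku iu; move: bS; rewrite -(bvert_inj _ iu) ?uS ?ku.
    have vb : kind v = 3 -> idx b <> idx v.
      by move=> kv iv; move: bS; rewrite (bvert_inj _ iv) ?vS ?kv.
    have [uab vab] : d u b = (d u a).+1 /\ d v a = (d v b).+1.
      have := dist_adj dP u ab; have := dist_triangle dP u b v.
      have := dist_adj dP v (etrans (adj_sym b a) ab); have := dist_triangle dP u a v.
      by rewrite (distC dP v a) (distC dP v b); move: E; clear; lia.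
    have u2 : kind u <> 2.
      by move=> ku; have := neck_dist u a; have := neck_dist u b; rewrite ka kb ku /arcdist; move: uab (ua ku); clear; lia.
    have v3 : kind v <> 3.
      by move=> kv; have := neck_dist v b; have := neck_dist v a; rewrite ka kb kv /arcdist; move: vab (vb kv); clear; lia.
    have u3 : kind u <> 3.
      move=> ku; have := neck_dist u a; have := neck_dist u b; rewrite ka kb ku /arcdist.
      have : d u v = d b v by rewrite !bdist_kind ?ku ?kb //; apply/eqP/nesym.
      by move: (ub ku) E; clear; lia.
    have v2 : kind v <> 2.
      move=> kv; have := neck_dist v a; have := neck_dist v b; rewrite ka kb kv /arcdist.
      have : d u v = d u a by rewrite !bdist_kind ?kv ?ka //; apply/eqP.
      by rewrite (distC dP v b); move: (va kv) E; clear; lia.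
    exists (u, v); last first.
      rewrite /= {2 3}Puv !mem_cat !inE !eqxx !orbT uS vS.
      by split=> //; [move: u2 u3|move: v2 v3]; clear; lia.
    have far u' : kind u' <> 2 -> kind u' <> 3 -> d u' a = d u' a0 /\ d u' b = d u' b0.
      by move=> ? ?; rewrite !bdist_kind ?ka ?kb ?ka0 ?kb0 //; apply/eqP.
    have := far u u2 u3; have := far v v2 v3.
    have : (u, v) \notin D.
      by apply/negP => /HD /(_ ka) /negP; apply; rewrite Puv mem_cat inE eqxx orbT.
    rewrite !inE uS vS /= => ->; move: u2 u3 v2 v3 uab vab; clear; lia.
  move=> [a b] [a' b'] [u v]; rewrite !inE /=.
  move=> /andP[/andP[/eqP ka _] /andP[/eqP kb _]] /andP[/andP[/eqP ka' _] /andP[/eqP kb' _]].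
  move=> [uvP aP bP /andP[_ /andP[/eqP u2 /eqP u3]] _] [_ aP' bP' _ _].
  have -> : a = a' by apply: (shortest_inj dP uvP aP aP'); rewrite !bdist_kind ?ka ?ka' //; exact/eqP.
  by have -> : b = b' by apply: (shortest_inj dP uvP bP bP'); rewrite !bdist_kind ?kb ?kb' //; exact/eqP.
have sizes : #|K 2| + #|K 3| + #|Low| + #|High| <= #|S|.
  have U (X Y : {set F}) : (forall x, x \in X -> x \notin Y) -> #|X| + #|Y| = #|X :|: Y|.
    move=> XY; rewrite cardsU (_ : X :&: Y = set0) ?cards0 ?subn0 //.
    by apply/setP => x; rewrite !inE; apply/negP => /andP[/XY /negP].
  rewrite !U; last first.
  - by move=> x; rewrite !inE; clear; lia.
  - by move=> x; rewrite !inE; clear; lia.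
  - by move=> x; rewrite !inE; clear; lia.
  apply: (@subset_leq_card F _ S); apply/subsetP => x; rewrite !inE; clear; lia.
have end_low x : kind x = 0 -> x \in Low.
  move=> kx; rewrite !inE (neck_end_in s0 comb_size_gt0 Seg kx) kx /=.
  by rewrite (@neck_arc _ _ _ x a0 2) ?(@neck_arc _ _ _ x b0 3) ?kx ?ka0 ?kb0 // /arcdist; lia.
have x01 : x0 != x1 by apply: neck_neq; lia.
have low2 : 2 <= #|Low|.
  apply: (@leq_trans #|[set x0; x1]|); first by rewrite cards2 x01.
  apply: (@subset_leq_card F _ Low); by apply/subsetP => x /set2P[]->; apply: end_low.
have prod_le : #|C 2| * #|C 3| <= #|Low| * #|High|.
  by have H := pass set0; rewrite setD0 cardsX in H; apply: H => u v y; rewrite inE.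
have prod_lt : #|Low| = 2 -> #|C 2| * #|C 3| < #|Low| * #|High|.
  move=> l2.
  have low0 x : x \in Low -> kind x = 0.
    have E : [set x0; x1] = Low :> {set F}.
      apply/eqP; rewrite eqEcard; apply/andP; split.
        by apply/subsetP => y /set2P[]->; apply: end_low.
      by rewrite cards2 l2 x01.
    by rewrite -E => /set2P[]->.
  have high x : x \in S -> kind x <> 0 -> kind x = 2 \/ kind x = 3 \/ d x b0 < d x a0.
    move=> xS kx; have [?|k2] := eqVneq (kind x) 2; first by left.
    have [?|k3] := eqVneq (kind x) 3; first by right; left.
    right; right; have := neck_dist x a0; have := neck_dist x b0; rewrite ka0 kb0.
    have : ~~ (d x a0 < d x b0).
      by apply/negP => xl; apply: kx; apply: low0; rewrite !inE xS k2 k3 xl.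
    by move: (kind_lt x) k2 k3; rewrite /arcdist; clear; lia.
  have bound x : x \in S -> kind x = 0 \/ 1 < kind x <= L + 2.
    move=> xS; have [?|kx] := eqVneq (kind x) 0; first by left.
    right; have := high x xS (elimN eqP kx); have := neck_dist x a0; have := neck_dist x b0.
    by rewrite ka0 kb0; move: (kind_lt x) kx L5; rewrite /arcdist; clear; lia.
  suff [v vH Hv] : exists2 v, v \in High & forall x, kind x = 2 -> x \notin P x0 v.
    have x0v : (x0, v) \in setX Low High by rewrite in_setX end_low.
    rewrite -[X in _ < X]cardsX (cardsD1 (x0, v)) x0v add1n ltnS; apply: pass => u w y.
    by rewrite inE => /eqP[-> ->]; apply: Hv.
  have x0q : adj x0 q.
    by rewrite adj_sym; apply: (neck_adj_lev s0 comb_size_gt0); rewrite kq k0 /nlev; case: eqP; lia.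
  have [u [v [t1 [t2 [uS vS uvP Puv E]]]]] := strong_oriented dP PS (PE _ _ x0q).
  have [kv far] : L <= kind v /\ (u = x0 \/ kind v = L + 2).
    have := neck_dist u x0; have := neck_dist q v; have := neck_dist u v.
    rewrite k0 i0 kq /arcdist => uv qv ux0.
    have uE : kind u = 0 -> idx u = 0 -> u = x0.
      by move=> ku iu; apply: bvert_inj; rewrite ?ku ?k0 ?iu ?i0.
    suff : L <= kind v /\ (kind u = 0 /\ idx u = 0 \/ kind v = L + 2).
      by case=> kv [[? ?]|?]; split=> //; [left; apply: uE|right].
    move: (bound u uS) (bound v vS) E uv qv ux0 L5; clear => bu bv E.
    by move=> [?|[?|[_ [uv0 [uvL uv]]]]] [?|[?|[_ [qv0 [qvL qv]]]]]; lia.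
  exists v.
    rewrite !inE vS; case: (high v vS); first by lia.
      by move=> ?; lia.
    case=> [?|->]; first by lia.
    by rewrite andbT; lia.
  move=> x kx; apply/negP => xP.
  have x0v : x0 != v by apply: neck_neq; lia.
  have [sP _] := PS _ _ x0S vS x0v.
  have x0x : d x0 x = 2 by apply: neck_arc; rewrite /arcdist ?k0 ?kx; move: L5; clear; lia.
  have qx : d q x = 3 by apply: neck_arc; rewrite /arcdist ?kq ?kx; move: L5; clear; lia.
  have x0q1 : d x0 q = 1 by apply/eqP; rewrite -(adjE dP).
  have := shortest_mem dP sP xP; rewrite x0x; have := neck_dist x v; have := neck_dist x0 v.
  have [kvL|kvL] := eqVneq (kind v) L; last first.
    by rewrite k0 kx /arcdist; move: (bound v vS) kv kvL L5; clear; lia.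
  case: far => [ux|]; last by rewrite kvL; clear; lia.
  have qP : q \in P x0 v by rewrite -ux Puv mem_cat !inE eqxx !orbT.
  by have := shortest_between dP sP qP xP; rewrite x0q1 x0x qx => /(_ isT).
have := KC 2 ltac:(lia); have := KC 3 ltac:(lia); rewrite /comb_size /= => C3 C2.
have := @count_ineq n #|C 2| #|C 3| #|Low| #|High|.
move: sizes low2 prod_le prod_lt C2 C3 n2; clear.
move: #|C 2| #|C 3| #|K 2| #|K 3| #|Low| #|High| #|S| => c2 c3 k2 k3 l r t; lia.
Qed.

(** The set S consists of level 3 and the levels 0 and L. With the vertices of
    level 2 numbered by residues modulo their number a, the path from the r-th
    vertex of level 0 to the j-th one of level 3 uses number 2 j + r, and the
    path between the j-th and the j'-th vertex of level 3 uses number j + j'.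
    So each edge from level 2 to level 3 is covered, the one from i to j by
    j' = i - j, or, if this is j itself, by the path from level 0 with r = 0.
    The paths from level L to the two ends on level 0 use different vertices
    of the chain. *)
Lemma comb_strong_le : exists S, strong_edge_geodetic_set S /\ #|S| <= n + 3.
Proof.
have L5 := comb_len_ge.
have [|mk mkP] := @bvert_mk (2 * L) comb_size _ isT; first by lia.
pose a := maxn 2 n.
have a0 : 0 < a by rewrite leq_max.
have szL : comb_size L = 1.
  by apply: comb_size_1; [lia..|]; apply/negP => /chain_lt; clear; lia.
pose S := [set x : F | kind x \in [:: 0; 3; L]]; exists S; split; last first.
  rewrite card_kinds ?big_cons ?big_nil ?szL /=.
  - by rewrite /comb_size /=; clear; lia.
  - by rewrite !inE; move: L5; clear; lia.
  - by move=> i; rewrite !inE; move: L5; clear; lia.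
have inS x : (x \in S) = [|| kind x == 0, kind x == 3 | kind x == L] by rewrite !inE.
pose Q u v :=
  if (kind u == 0) && (kind v == 0) then (if idx u < idx v then [:: u; v] else [::]) else
  if (kind u == 0) && (kind v == 3) then
    route mk u v 0 3 (fun i => if i == 2 then (2 * idx v + idx u) %% a else 0) else
  if (kind u == 3) && (kind v == 3) then
    (if idx u < idx v then [:: u; mk 2 ((idx u + idx v) %% a); v] else [::]) else
  if (kind u == 3) && (kind v == L) then route mk u v 3 (L - 3) (fun=> 0) else
  if (kind u == L) && (kind v == 0) then
    route mk u v L L (fun i => if chain i then idx v else 0) else [::].
have rP03 u v : forall i, 0 < i < 0 + 3 ->
    (if i == 2 then (2 * idx v + idx u) %% a else 0) < comb_size i.
  by move=> i i3; case: eqP => [->|_]; [rewrite ltn_mod|apply: comb_size_gt0; lia].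
have rP3L i : 3 < i < 3 + (L - 3) -> 0 < comb_size i by move=> ?; apply: comb_size_gt0; lia.
have rPL0 v : kind v = 0 -> forall i, L < i < L + L -> (if chain i then idx v else 0) < comb_size i.
  move=> kv i iL; case: ifP => ci; last by apply: comb_size_gt0; lia.
  by rewrite comb_size_chain //; have := idx_lt v; rewrite kv.
have mid c : c < a -> kind (mk 2 c) = 2 /\ idx (mk 2 c) = c.
  by move=> ca; apply: mkP => //; lia.
have nLL : nlev L (L + L) = 0 by rewrite /nlev; case: eqP; lia.
have nl3 : nlev L (0 + 3) = 3 by rewrite /nlev; case: eqP; lia.
have nlL : nlev L (3 + (L - 3)) = L by rewrite /nlev; case: eqP; lia.
have [L0 L3] : (L == 0) = false /\ (L == 3) = false by move: L5; clear; lia.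
apply: (strong_setP dP (Q := Q)) => [u v uS vS uv|].
  move: uS vS; rewrite !inS => /or3P[] /eqP ku /or3P[] /eqP kv;
    rewrite /Q ku kv /= ?[0 == L]eq_sym ?[3 == L]eq_sym ?L0 ?L3 ?eqxx //=.
  - case: ifP => // iuv _; split; last by case: ifP => //; move: iuv; clear; lia.
    by apply: (shortest1 dP); apply: (neck_adj0 s0 comb_size_gt0).
  - move=> _; split=> //; apply: (neck_route s0 comb_size_gt0 mkP) (rP03 _ _) => //; lia.
  - case: ifP => // iuv _; split; last by case: ifP => //; move: iuv; clear; lia.
    have [kc ic] := mid _ (ltn_pmod (idx u + idx v) a0).
    apply: (shortest2 dP); first 1 last.
    + by apply: (neck_adj_lev s0 comb_size_gt0); rewrite kc kv /nlev; case: eqP; lia.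
    + by have := neck_dist u v; rewrite ku kv; move: iuv; clear; lia.
    by rewrite adj_sym; apply: (neck_adj_lev s0 comb_size_gt0); rewrite kc ku /nlev; case: eqP; lia.
  - move=> _; split=> //; apply: (neck_route s0 comb_size_gt0 mkP) rP3L => //; lia.
  - move=> _; split=> //; apply: (neck_route s0 comb_size_gt0 mkP) (rPL0 v kv) => //; lia.
apply: (neck_edge_ind s0 comb_size_gt0) => [x y [u [v [uS vS uv E]]]|x y kx ky ix iy|x y E].
- by exists u, v; split=> //; rewrite edge_onC.
- exists x, y; rewrite !inS kx ky /Q kx ky ix iy /=; split=> //; first by apply: neck_neq; lia.
  by rewrite /edge_on /= !inE !eqxx.
have [xL yL] := (kind_lt x, kind_lt y); have ny := nlevE L (kind x).+1; rewrite -E in ny.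
have single z i : kind z = i -> comb_size i = 1 -> idx z = 0.
  by move=> kz si; have := idx_lt z; rewrite kz si; lia.
have edge03 u v : kind u = 0 -> kind v = 3 -> kind x < 3 ->
    (if kind x == 0 then x = u else if kind x == 2 then idx x = (2 * idx v + idx u) %% a
     else idx x = 0) ->
    (if kind x == 2 then y = v else if kind x == 1 then idx y = (2 * idx v + idx u) %% a
     else idx y = 0) ->
    exists u v, [/\ u \in S, v \in S, u != v & edge_on x y (Q u v)].
  move=> ku kv x3 xE yE; exists u, v; rewrite !inS ku kv; split=> //; first by apply: neck_neq; lia.
  rewrite /Q ku kv /=; apply: (neck_route_edge s0 mkP) => //; rewrite ?nl3 //; try lia.
  - exact: rP03.
  - by move: xE; case: eqP => // _; case: eqP.
  - by move: yE x3; case: (kind x) => [|[|[|?]]].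
have edge3L u v : kind u = 3 -> kind v = L -> 3 <= kind x < L -> (kind x = 3 -> x = u) ->
    exists u v, [/\ u \in S, v \in S, u != v & edge_on x y (Q u v)].
  move=> ku kv xi xu; exists u, v; rewrite !inS ku kv !eqxx !orbT; split=> //.
    by apply: neck_neq; move: ku kv L5; clear; lia.
  have low z : 3 < kind z <= L -> comb_size (kind z) = 1.
    by move=> zi; apply: comb_size_1; [lia..|]; apply/negP => /chain_lt; move: zi; clear; lia.
  rewrite /Q ku kv L0 L3 !andbF /= eqxx; apply: (neck_route_edge s0 mkP) => //; try lia.
    by case: eqP => [/xu//|x3]; apply: (single x) (low x _); lia.
  case: eqP => [x3|x3]; last by apply: (single y) (low y _); lia.
  by apply: (neck_single s0); rewrite ?low ?kv //; lia.
have edgeL0 v : kind v = 0 -> L <= kind x -> (chain (kind x) -> idx x = idx v) ->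
    (chain (kind x).+1 -> idx y = idx v) -> (kind y = 0 -> y = v) ->
    exists u v, [/\ u \in S, v \in S, u != v & edge_on x y (Q u v)].
  move=> kv xi xv yv yv0; have [||u [ku iu]] := @neck_vertex _ comb_size L2 L 0; rewrite ?szL //; first lia.
  exists u, v; rewrite !inS ku kv !eqxx !orbT; split=> //; first by apply: neck_neq; lia.
  have high z : L < kind z -> ~~ chain (kind z) -> idx z = 0.
    by move=> zi zc; apply: (single z) => //; apply: comb_size_1; lia.
  rewrite /Q ku kv L0 L3 !eqxx /=; apply: (neck_route_edge s0 mkP) => //; try lia.
  - exact: rPL0.
  - case: eqP => [xL'|xL']; first by apply: (neck_single s0); rewrite ?xL' ?ku.
    by case: ifP => [/xv//|/negbT cx]; apply: high cx; lia.
  - case: eqP => [xL'|xL']; first by apply: yv0; lia.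
    have yE : kind y = (kind x).+1 by lia.
    by case: ifP => [/yv//|/negbT cx]; apply: high; rewrite yE //; lia.
have comb_size0 := s0; have comb_size3 : comb_size 3 = n by []; have comb_size2 : comb_size 2 = a by [].
have := idx_lt x; have := idx_lt y.
have [x3|x3] := ltnP (kind x) 3; last first => iy ix.
  have [xL'|xL'] := ltnP (kind x) L.
    have [||v [kv iv]] := @neck_vertex _ comb_size L2 L 0; rewrite ?szL //; first lia.
    have [kx|kx] := eqVneq (kind x) 3.
      by apply: (edge3L x v) => //; lia.
    have [|//|u [ku iu]] := @neck_vertex _ comb_size L2 3 0; first lia.
    by apply: (edge3L u v) => //; lia.
  (* No two consecutive levels are in the chain, so a single index of level 0
     can be read off from the edge. *)
  have [y0|y0] := eqVneq (kind y) 0.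
    have xE : kind x = (2 * L).-1 by lia.
    by apply: (edgeL0 y) => //; move/chain_lt; rewrite xE; lia.
  have yE : kind y = (kind x).+1 by lia.
  pose r := if chain (kind x) then idx x else if chain (kind y) then idx y else 0.
  have [||v [kv iv]] := @neck_vertex _ comb_size L2 0 r; first lia.
    rewrite /r; case: ifP => cx; first by move: ix; rewrite comb_size_chain.
    by case: ifP => cy //; move: iy; rewrite comb_size_chain.
  apply: (edgeL0 v) => //; rewrite ?iv /r -?yE; [by move=> ->| |by move=> y0'; rewrite y0' in y0].
  move=> cy; rewrite cy; case: ifP => // cx; move: cx cy; rewrite yE /chain; clear; lia.
have [x0|x0] := eqVneq (kind x) 0.
  have [|//|v [kv iv]] := @neck_vertex _ comb_size L2 3 0; first lia.
  apply: (edge03 x v); rewrite ?x0 //=; apply: (single y 1) => //; lia.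
have [x1|x1] := eqVneq (kind x) 1.
  have y2 : kind y = 2 by lia.
  rewrite y2 comb_size2 in iy.
  have [|//|u [ku iu]] := @neck_vertex _ comb_size L2 0 (idx y %% 2); first lia.
    by rewrite s0 ltn_mod.
  have [|//|v [kv iv]] := @neck_vertex _ comb_size L2 3 (idx y %/ 2); first lia.
    by move: iy; rewrite comb_size3 /a; clear - n0; lia.
  apply: (edge03 u v); rewrite ?x1 //=; first by apply: (single x 1).
  by rewrite iu iv [2 * (_ %/ _)]mulnC -divn_eq modn_small.
have x2 : kind x = 2 by lia.
have y3 : kind y = 3 by lia.
rewrite x2 comb_size2 in ix; rewrite y3 comb_size3 in iy.
have [xE|xE] := eqVneq (idx x) ((2 * idx y) %% a).
  have [|//|u [ku iu]] := @neck_vertex _ comb_size L2 0 0; first lia.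
  by apply: (edge03 u y); rewrite ?x2 ?iu ?addn0.
(* If level 3 is a single vertex, level 2 has two, reached from the two ends. *)
have [n1|n2] := leqP n 1.
  have [|//|u [ku iu]] := @neck_vertex _ comb_size L2 0 (idx x); first lia.
    by move: ix; rewrite s0 /a; clear - n1; lia.
  apply: (edge03 u y); rewrite ?x2 //= iu (_ : idx y = 0) ?muln0 ?add0n ?modn_small //; lia.
have an : a = n by rewrite /a; lia.
rewrite an in xE ix.
pose j := (idx x + (n - idx y)) %% n.
have jE : (idx y + j) %% n = idx x.
  by rewrite modnDmr addnCA subnKC ?modnDr ?modn_small //; lia.
have jy : j <> idx y by move=> E'; move/eqP: xE; apply; rewrite -jE E' addnn (mul2n (idx y)).
have [||w [kw iw]] := @neck_vertex _ comb_size L2 3 j; rewrite ?comb_size3 ?ltn_mod //; first lia.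
have xm : mk 2 (idx x) = x.
  by have [|? ?] := mid (idx x); [rewrite an|apply: bvert_inj; rewrite ?x2].
have [yw|wy] := ltnP (idx y) (idx w).
  exists y, w; rewrite !inS y3 kw; split=> //; first by apply: neck_neq; move: yw; clear; lia.
  by rewrite /Q y3 kw /= yw iw an jE xm /edge_on /= !inE !eqxx ?orbT.
have {}wy : idx w < idx y by move: wy jy iw; clear; lia.
exists w, y; rewrite !inS y3 kw; split=> //; first by apply: neck_neq; move: wy; clear; lia.
rewrite /Q y3 kw /= wy.
by rewrite iw an (addnC j) jE xm /edge_on /= !inE !eqxx ?orbT.
Qed.

Lemma comb_realizes : realizes (n + 3) (2 + maxn 2 n + (if 1 < n then n else 0) + 2 * m + e).
Proof.
have L5 := comb_len_ge; have c0 i : i <= L -> ~~ chain i.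
  by move=> iL; apply/negP => /chain_lt; move: iL; clear; lia.
exists F; split; first exact: (neck_connected comb_size_gt0).
split.
  apply: (neck_geodetic L2 s0 comb_size_gt0 (i := 4)); first by lia.
    by apply: comb_size_1; [lia..|apply: c0; lia].
  by apply: comb_size_1; [lia..|]; have := comb_len_odd; rewrite /chain; lia.
split; first by apply: (neck_edge_geodetic L2 s0 comb_size_gt0); apply: comb_size_1; [lia..|apply: c0].
split; last exact: comb_meg.
by apply: min_card_le; [exact: comb_strong_le|exact: comb_strong_ge].
Qed.

End Comb.

(** * The pair (4, 4) *)
Section Hexagon.

Definition hex_size i := if i == 0 then 2 else 1.

Lemma hex_size_gt0 i : i < 2 * 3 -> 0 < hex_size i.
Proof. by rewrite /hex_size; case: ifP. Qed.

Let L2 : 2 < 3 := isT.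
Let s0 : hex_size 0 = 2 := erefl.
Let T := necklace hex_size L2.
Let dP : is_dist (G := T) (@bdist (2 * 3) hex_size (ndk 3)) :=
  bdist_is_dist (ndk_dist L2) hex_size_gt0.

Lemma hex_realizes : realizes 4 4.
Proof.
pose M : {set T} := [set x : T | kind x \in [:: 0; 2; 4]].
have MM : meg_set M.
  apply: (neck_meg s0 hex_size_gt0) => // i i6.
  exists (if i < 2 then 0 else if i < 4 then 2 else 4).
  exists (if i < 2 then 2 else if i < 4 then 4 else 6).
  have hex_size1 j : 0 < j -> hex_size j = 1 by case: j.
  by have [i2|i2] := ltnP i 2; [|have [i4|i4] := ltnP i 4];
    split=> //; try lia; move=> j jj; apply: hex_size1; lia.
have cM : #|M| <= 4.
  rewrite card_kinds ?big_cons ?big_nil // => i.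
  by rewrite !inE => /or3P[] /eqP->.
have ge4 (S : {set T}) : strong_edge_geodetic_set S -> 4 <= #|S| by apply: (neck_strong_ge4 s0 hex_size_gt0).
exists T; split; first exact: (neck_connected hex_size_gt0).
split; first exact: (neck_geodetic L2 s0 hex_size_gt0 (i := 1)).
split; first exact: (neck_edge_geodetic L2 s0 hex_size_gt0).
split; apply: min_card_le => [|S SS].
- by exists M; split; [exact: (meg_strong dP MM)|].
- exact: ge4.
- by exists M.
- exact: ge4 _ (meg_strong dP SS).
Qed.

End Hexagon.

(** * All pairs *)

Theorem theorem11 (c d : nat) (hc : 4 <= c) (hd : c <= d) :
  exists G : sgraph,
    connected_graph G /\
    geodetic_number G 2 /\
    edge_geodetic_number G 3 /\
    strong_edge_geodetic_number G c /\
    meg_number G d.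
Proof.
suff : realizes c d by [].
have neck n m e : 0 < n -> e <= 1 -> 0 < m + e -> c = n + 3 ->
    d = 2 + maxn 2 n + (if 1 < n then n else 0) + 2 * m + e -> realizes c d.
  by move=> n0 e1 me -> ->; apply: comb_realizes.
have [c4|c5] := leqP c 4.
  have c_4 : c = 4 by lia.
  have [d4|d5] := leqP d 4; first by rewrite c_4 (_ : d = 4); [exact: hex_realizes|lia].
  by apply: (neck 1 (d - 4)./2 (odd (d - 4))) => /=; lia.
have [d2|d3] := leqP d (c + 2).
  rewrite (_ : d = c - 4 + (d - c + 1) + 3); last by lia.
  by rewrite {1}(_ : c = c - 4 + 4); [apply: oct_realizes; lia|lia].
have [dl|dl] := leqP d (2 * c - 4).
  rewrite (_ : d = c + (d - c - 2) + 2); last by lia.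
  by apply: bulge_realizes; lia.
by apply: (neck (c - 3) (d + 4 - 2 * c)./2 (odd (d + 4 - 2 * c))); try case: ifP; lia.
Qed.
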